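(* Let $\Phi\in H^\infty_{M_n}$ be such that $\Phi^*$ is of bounded type, and write $$\Phi=\Phi_i\Phi_e\ \ (\text{inner-outer factorization}),\qquad \Phi=A^*\Theta\ \ (\text{left coprime}).$$ If $\det\Phi\not\equiv0$, then $\deg(\Phi_i)\le\deg(\Theta)$. In particular, if (in addition) $\Phi$ is a rational function, then $\Phi_i$ is a finite Blaschke-Potapov product.
   Context: $H^2_{M_n}$, $H^\infty_{M_n}$: $n\times n$ matrix functions with entries in the Hardy spaces $H^2,H^\infty$ of the unit disk $\mathbb D$; $H^2_{\mathbb C^n}$ is the $\mathbb C^n$-valued Hardy space. A matrix function on the unit circle $\mathbb T$ is of bounded type if each entry equals a.e. on $\mathbb T$ a quotient of two $H^\infty$ functions. $\Theta\in H^\infty_{M_{n\times m}}$ is inner if $\Theta^*\Theta=I_m$ a.e. on $\mathbb T$. An inner $\Delta$ is a left inner divisor of $F$ if $F=\Delta G$ with $G$ a matrix $H^2$-function; two functions are left coprime if their only common left inner divisors are unitary constants. ''$\Phi=A^*\Theta$ (left coprime)'' means $\Theta\in H^\infty_{M_n}$ is inner, $A\in H^2_{M_n}$, and $A,\Theta$ are left coprime. Inner-outer factorization: $\Phi=\Phi_i\Phi_e$ with $\Phi_i\in H^\infty_{M_{n\times r}}$ inner and $\Phi_e\in H^2_{M_{r\times n}}$ outer, i.e. $\Phi_e\cdot\{\mathbb C^n\text{-valued polynomials}\}$ is dense in $H^2_{\mathbb C^r}$ (when $\det\Phi\not\equiv0$ one has $r=n$). For a square inner matrix function $\Theta\in H^\infty_{M_n}$,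 $\deg(\Theta):=\dim\bigl(H^2_{\mathbb C^n}\ominus\Theta H^2_{\mathbb C^n}\bigr)\in\{0,1,2,\dots,\infty\}$. A finite Blaschke-Potapov product is $\nu\prod_{m=1}^M\bigl(b_mP_m+(I-P_m)\bigr)$ with $\nu$ a constant unitary $n\times n$ matrix, each $b_m$ a Blaschke factor $\frac{z-\lambda}{1-\overline\lambda z}$ ($\lambda\in\mathbb D$), and $P_m$ orthogonal projections on $\mathbb C^n$. *)

(* Defs.v *)
From HB Require Import structures.
From mathcomp Require Import all_boot all_order all_algebra.
From mathcomp Require Import complex.
From mathcomp Require Import all_classical all_reals all_analysis.

Set Implicit Arguments.
Unset Strict Implicit.
Unset Printing Implicit Defensive.

Import Order.TTheory GRing.Theory Num.Theory.
Import numFieldNormedType.Exports.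

Local Open Scope classical_set_scope.
Local Open Scope ring_scope.
Local Open Scope complex_scope.
Local Open Scope sesquilinear_scope.

(* A function on the unit circle T is a function on R[i] of which only the
   values on T matter, up to a.e. equality: T is parametrized by
   t |-> exp (2 i pi t), so that its normalized arc length measure is the
   Lebesgue measure on [0, 1]. *)

Definition cis {R : realType} (t : R) : R[i] :=
  cos (2 * pi * t) +i* sin (2 * pi * t).

Definition arc (R : realType) : {measure set (measurableTypeR R) -> \bar R} :=
  mrestr (@lebesgue_measure R) (measurable_itv `[0, 1]).

Definition aeT {R : realType} (P : R[i] -> Prop) : Prop :=
  {ae arc R, forall t, P (cis t)}.

Definition intT {R : realType} (f : R[i] -> R[i]) : R[i] :=
  (\int[arc R]_t complex.Re (f (cis t)))
  +i* (\int[arc R]_t complex.Im (f (cis t))).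

(* By periodicity, measurability of t |-> f (cis t) on the whole of R is the
   same as measurability on [0, 1]. *)
Definition LT {R : realType} (p : \bar R) (f : R[i] -> R[i]) : Prop :=
  (fun t => complex.Re (f (cis t))) \in Lfun (arc R) p /\
  (fun t => complex.Im (f (cis t))) \in Lfun (arc R) p.

Definition fourier {R : realType} (f : R[i] -> R[i]) (k : int) : R[i] :=
  intT (fun z => f z * z ^ (- k)).

(* Hardy spaces of the disk, as spaces of boundary functions on T *)
Definition Hardy {R : realType} (p : \bar R) (f : R[i] -> R[i]) : Prop :=
  LT p f /\ forall k : int, k < 0 -> fourier f k = 0.

Definition Hardymx {R : realType} (p : \bar R) {m n : nat}
    (F : R[i] -> 'M[R[i]]_(m, n)) : Prop :=
  forall i j, Hardy p (fun z => F z i j).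

Notation H2 := (Hardymx 2%:E).
Notation Hoo := (Hardymx +oo%E).

Definition adjoint {R : realType} {m n : nat}
    (F : R[i] -> 'M[R[i]]_(m, n)) (z : R[i]) : 'M[R[i]]_(n, m) :=
  (F z)^t*.

Definition bounded_type {R : realType} {m n : nat}
    (F : R[i] -> 'M[R[i]]_(m, n)) : Prop :=
  forall i j, exists u v : R[i] -> R[i],
    [/\ Hardy +oo u, Hardy +oo v &
        aeT (fun z => v z != 0 /\ F z i j = u z / v z)].

Definition rational_mx {R : realType} {m n : nat}
    (F : R[i] -> 'M[R[i]]_(m, n)) : Prop :=
  forall i j, exists p q : {poly R[i]},
    q != 0 /\ aeT (fun z => F z i j = p.[z] / q.[z]).

Definition inner {R : realType} {n m : nat}
    (Theta : R[i] -> 'M[R[i]]_(n, m)) : Prop :=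
  Hoo Theta /\ aeT (fun z => adjoint Theta z *m Theta z = 1%:M).

Definition dotT {R : realType} {n : nat} (f g : R[i] -> 'cV[R[i]]_n) : R[i] :=
  intT (fun z => (adjoint g z *m f z) 0 0).

Definition sqnormT {R : realType} {n : nat}
    (f : R[i] -> 'cV[R[i]]_n) : \bar R :=
  (\int[arc R]_t (\sum_(i < n) Normc.normc (f (cis t) i 0) ^+ 2)%:E)%E.

Definition outer {R : realType} {r n : nat}
    (F : R[i] -> 'M[R[i]]_(r, n)) : Prop :=
  H2 F /\
  forall (h : R[i] -> 'cV[R[i]]_r) (e : R), H2 h -> 0 < e ->
    exists p : 'cV[{poly R[i]}]_n,
      (sqnormT (fun z => F z *m map_mx (horner^~ z) p - h z)%R
         < (e ^+ 2)%:E)%E.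

Definition inner_outer_factorization {R : realType} {n m r : nat}
    (Phi : R[i] -> 'M[R[i]]_(n, m))
    (Phi_i : R[i] -> 'M[R[i]]_(n, r)) (Phi_e : R[i] -> 'M[R[i]]_(r, m)) : Prop :=
  [/\ inner Phi_i, outer Phi_e & aeT (fun z => Phi z = Phi_i z *m Phi_e z)].

Definition left_inner_divisor {R : realType} {n m k : nat}
    (Delta : R[i] -> 'M[R[i]]_(n, k)) (F : R[i] -> 'M[R[i]]_(n, m)) : Prop :=
  inner Delta /\
  exists G : R[i] -> 'M[R[i]]_(k, m),
    H2 G /\ aeT (fun z => F z = Delta z *m G z).

Definition unitary_constant {R : realType} {n k : nat}
    (F : R[i] -> 'M[R[i]]_(n, k)) : Prop :=
  exists U : 'M[R[i]]_(n, k),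
    [/\ U \is unitarymx, U^t* \is unitarymx & aeT (fun z => F z = U)].

Definition left_coprime {R : realType} {n m p : nat}
    (F : R[i] -> 'M[R[i]]_(n, m)) (G : R[i] -> 'M[R[i]]_(n, p)) : Prop :=
  forall (k : nat) (Delta : R[i] -> 'M[R[i]]_(n, k)),
    left_inner_divisor Delta F -> left_inner_divisor Delta G ->
    unitary_constant Delta.

Definition left_coprime_factorization {R : realType} {n : nat}
    (Phi A Theta : R[i] -> 'M[R[i]]_n) : Prop :=
  [/\ inner Theta, H2 A, left_coprime A Theta &
      aeT (fun z => Phi z = adjoint A z *m Theta z)].

(* f belongs to the orthogonal complement of Theta H^2 in H^2 *)
Definition model_space {R : realType} {n : nat}
    (Theta : R[i] -> 'M[R[i]]_n) (f : R[i] -> 'cV[R[i]]_n) : Prop :=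
  H2 f /\
  forall g : R[i] -> 'cV[R[i]]_n, H2 g ->
    dotT f (fun z => Theta z *m g z) = 0.

Definition lin_indepT {R : realType} {n k : nat}
    (f : 'I_k -> R[i] -> 'cV[R[i]]_n) : Prop :=
  forall c : 'I_k -> R[i],
    aeT (fun z => \sum_(i < k) c i *: f i z = 0) -> forall i, c i = 0.

(* The dimension of the model space, in {0, 1, 2, ..., +oo}, as the supremum
   of the sizes of its linearly independent families. *)
Definition deg {R : realType} {n : nat} (Theta : R[i] -> 'M[R[i]]_n) : \bar R :=
  ereal_sup [set (k%:R : R)%:E | k in [set k : nat |
    exists f : 'I_k -> R[i] -> 'cV[R[i]]_n,
      (forall i, model_space Theta (f i)) /\ lin_indepT f]].

Definition blaschke {R : realType} (l z : R[i]) : R[i] :=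
  (z - l) / (1 - l^* * z).

Definition orthogonal_projection {R : realType} {n : nat}
    (P : 'M[R[i]]_n) : Prop :=
  P *m P = P /\ P^t* = P.

Definition finite_blaschke_potapov {R : realType} {n : nat}
    (F : R[i] -> 'M[R[i]]_n) : Prop :=
  exists (M : nat) (nu : 'M[R[i]]_n) (l : 'I_M -> R[i])
         (P : 'I_M -> 'M[R[i]]_n),
    [/\ nu \is unitarymx,
        forall m, `|l m| < 1,
        forall m, orthogonal_projection (P m) &
        aeT (fun z => F z = nu *m \big[mulmx/1%:M]_(m < M)
                              (blaschke (l m) z *: P m + (1%:M - P m)))].

(* Main.v *)
Require Import Defs.
From mathcomp Require Import all_boot all_order all_algebra.
From mathcomp Require Import complex.
From mathcomp Require Import all_classical all_reals all_analysis.
From mathcomp Require Import measurable_realfun ess_sup_inf measure_negligible.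
From mathcomp Require Import ring lra.

(** Let K(Theta) denote the orthogonal complement of Theta H^2 in H^2.

    The degree inequality comes from a linear map. If f is in K(Phi_i), then f
    is orthogonal to Phi H^2, because Phi = Phi_i Phi_e; in other words Phi^* f
    is orthogonal to H^2. Since Phi^* = Theta^* A, the function
    Theta Phi^* f = A f lies in H^2 and is orthogonal to Theta H^2: this is
    [model_space_transfer]. The map from K(Phi_i) to K(Theta) so obtained is
    injective by [adjoint_inj]: if Phi_e^* Phi_i^* f = 0, the density that
    defines outer functions makes all the Fourier coefficients of Phi_i^* f
    vanish. Squareness of Phi_i, that is r = n, is a matter of ranks.

    If Phi is rational, q Phi = P with a polynomial q and a polynomial matrix P,
    and f is sent injectively to P^* f. For f in K(Phi_i) this function has
    Fourier coefficients only at finitely many indices that do not depend on f,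
    so that K(Phi_i) has finite dimension, as [rational_deg_le] states. It
    remains to see that an inner function Theta with a finite-dimensional K(Theta)
    is a Blaschke-Potapov product ([inner_finite_deg]), by induction on the
    dimension. The backward shift preserves K(Theta) and maps the columns of
    Theta into it. If K(Theta) = 0, then Theta is therefore constant. Otherwise
    the backward shift has an eigenvector in K(Theta), necessarily of the form
    v / (1 - mu z) with |mu| < 1 ([model_space_kernel], [kernel_lt1]). That it
    is orthogonal to Theta H^2 means that v^* Theta vanishes at the conjugate of
    mu, hence Theta = B Psi, where B = b P + (1 - P), b is the Blaschke factor
    with that zero, P is the projection onto v, and Psi is inner
    ([quotient_factor_inner]). As B K(Psi) is contained in K(Theta) and
    orthogonal to the eigenvector, the dimension drops ([deg_le_quotient]).

    Hardy spaces being defined by Fourier coefficients of boundary functions,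
    the analytic input is that products of H^2 functions have no coefficients
    of negative index ([fourier_Hardy2M]) and that the coefficients determine a
    function ([fourier_eq0_ae]). Both follow from the density of analytic
    polynomials in H^2 ([Hardy2_approx]), and this from the density of
    trigonometric polynomials in L^2 ([trig_approx_L2]). For the latter, the
    measurable sets whose indicators can be approximated form a sigma-algebra,
    and it contains the half circles because the sign function on [-1, 1] is a
    bounded limit of polynomials. *)

Set Implicit Arguments.
Unset Strict Implicit.
Unset Printing Implicit Defensive.

Import Order.TTheory GRing.Theory Num.Theory.
Import numFieldNormedType.Exports.
Import HBSimple HBNNSimple.

Local Open Scope classical_set_scope.
Local Open Scope ring_scope.

(** * Density of the trigonometric polynomials in L^2 *)

Section TrigonometricDensity.
Context {R : realType}.
Implicit Types (u v p : R -> R) (e M : R) (A B : set R).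
Notation mu := (Defs.arc R).

Lemma arcT : Defs.arc R setT = 1%E.
Proof.
rewrite /Defs.arc /= /mrestr setTI lebesgue_measure_itv /= lte_fin ltr01.
by rewrite oppr0 adde0.
Qed.

Lemma ae_arcS (P Q : R -> Prop) : (forall t, P t -> Q t) ->
  {ae mu, forall t, P t} -> {ae mu, forall t, Q t}.
Proof. by have F := ae_filter_ringOfSetsType mu; exact: filterS. Qed.

Lemma ae_arcI (P Q : R -> Prop) :
  {ae mu, forall t, P t} -> {ae mu, forall t, Q t} ->
  {ae mu, forall t, P t /\ Q t}.
Proof. by have F := ae_filter_ringOfSetsType mu; exact: filterI. Qed.

Definition sqnorm u : \bar R := (\int[mu]_t (u t ^+ 2)%:E)%E.

(** Products are built in because the sets with an approximable indicator have
    to be stable under intersection. *)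
Inductive trigp : (R -> R) -> Prop :=
| trigp_cst c : trigp (fun=> c)
| trigp_cos : trigp (fun t => cos (2 * pi * t))
| trigp_sin : trigp (fun t => sin (2 * pi * t))
| trigpD p q : trigp p -> trigp q -> trigp (fun t => p t + q t)
| trigpM p q : trigp p -> trigp q -> trigp (fun t => p t * q t).

Definition trig_approx u : Prop :=
  forall e, 0 < e -> exists2 p, trigp p & (sqnorm (u \- p)%R < e%:E)%E.

Definition bounded_mfun u : Prop :=
  measurable_fun setT u /\ exists M, forall t, `|u t| <= M.

Lemma measurable_cos2pi : measurable_fun setT (fun t : R => cos (2 * pi * t)).
Proof.
apply: continuous_measurable_fun => t.
apply: (@continuous_comp _ _ _ (fun t => 2 * pi * t) cos).
  exact: mulrl_continuous.
exact: continuous_cos.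
Qed.

Lemma measurable_sin2pi : measurable_fun setT (fun t : R => sin (2 * pi * t)).
Proof.
apply: continuous_measurable_fun => t.
apply: (@continuous_comp _ _ _ (fun t => 2 * pi * t) sin).
  exact: mulrl_continuous.
exact: continuous_sin.
Qed.

Lemma bounded_mfun_cst c : bounded_mfun (fun=> c).
Proof. by split; [exact: measurable_cst|exists `|c|]. Qed.

Lemma bounded_mfunD u v :
  bounded_mfun u -> bounded_mfun v -> bounded_mfun (fun t => u t + v t).
Proof.
move=> [mu' [A uA]] [mv [B vB]]; split; first exact: measurable_funD.
by exists (A + B) => t; apply: le_trans (ler_normD _ _) _; exact: lerD.
Qed.

Lemma bounded_mfunM u v :
  bounded_mfun u -> bounded_mfun v -> bounded_mfun (fun t => u t * v t).
Proof.
move=> [mu' [A uA]] [mv [B vB]]; split; first exact: measurable_funM.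
by exists (A * B) => t; rewrite normrM; exact: ler_pM.
Qed.

Lemma trigp_bounded_mfun p : trigp p -> bounded_mfun p.
Proof.
elim=> [c| | |p' q _ + _|p' q _ + _].
- exact: bounded_mfun_cst.
- by split; [exact: measurable_cos2pi|exists 1 => t; exact: cos_max].
- by split; [exact: measurable_sin2pi|exists 1 => t; exact: sin_max].
- exact: bounded_mfunD.
- exact: bounded_mfunM.
Qed.

Lemma measurable_sqr u : measurable_fun setT u ->
  measurable_fun setT (fun t => (u t ^+ 2)%:E).
Proof. by move=> mu'; apply/measurable_EFinP; exact: measurable_funX. Qed.

Lemma sqnormD u v : measurable_fun setT u -> measurable_fun setT v ->
  (sqnorm (u \+ v)%R <= 2%:E * sqnorm u + 2%:E * sqnorm v)%E.
Proof.
move=> mu' mv; rewrite /sqnorm.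
have mu2 := measurable_sqr mu'; have mv2 := measurable_sqr mv.
rewrite -!ge0_integralZl //; try by [move=> t _; rewrite lee_fin sqr_ge0].
rewrite -ge0_integralD //; try by [move=> t _;
  rewrite -EFinM lee_fin mulr_ge0// sqr_ge0].
- apply: ge0_le_integral => //.
  + by move=> t _; rewrite lee_fin sqr_ge0.
  + by apply: measurable_sqr; exact: measurable_funD.
  + by apply: emeasurable_funD; apply: measurable_funeM.
  + move=> t _; rewrite -!EFinM -EFinD lee_fin /=.
    by have := sqr_ge0 (u t - v t); nra.
- exact: measurable_funeM.
- exact: measurable_funeM.
Qed.

Lemma sqnormM u v M : measurable_fun setT u -> measurable_fun setT v ->
  (forall t, `|v t| <= M) ->
  (sqnorm (u \* v)%R <= (M ^+ 2)%:E * sqnorm u)%E.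
Proof.
move=> mu' mv vM; rewrite /sqnorm.
have mu2 := measurable_sqr mu'.
rewrite -ge0_integralZl ?lee_fin ?sqr_ge0 //; last by move=> t _;
  rewrite lee_fin sqr_ge0.
apply: ge0_le_integral => //.
- by move=> t _; rewrite lee_fin sqr_ge0.
- by apply: measurable_sqr; exact: measurable_funM.
- exact: measurable_funeM.
- move=> t _; rewrite -EFinM lee_fin /= exprMn mulrC ler_wpM2r ?sqr_ge0//.
  rewrite -(real_normK (num_real (v t))) lerXn2r ?nnegrE//.
  exact: le_trans (vM t).
Qed.

Lemma trig_approx_trigp p : trigp p -> trig_approx p.
Proof.
move=> tp e e0; exists p => //; rewrite /sqnorm (eq_integral (cst 0%E))
  ?integral0//.
by move=> t _ /=; rewrite subrr expr0n.
Qed.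

(** The triangle inequality, in the form (a + b)^2 <= 2 a^2 + 2 b^2. *)
Lemma trig_approx_closed u : measurable_fun setT u ->
  (forall e, 0 < e -> exists v, [/\ measurable_fun setT v, trig_approx v
     & (sqnorm (u \- v)%R < e%:E)%E]) -> trig_approx u.
Proof.
move=> mu' H e e0; have e4 : 0 < e / 4 by rewrite divr_gt0.
have [v [mv av uv]] := H _ e4; have [p tp vp] := av _ e4; exists p => //.
have [mp _] := trigp_bounded_mfun tp.
have -> : (u \- p = (u \- v) \+ (v \- p))%R.
  by apply/funext => t /=; rewrite addrA subrK.
apply: le_lt_trans (sqnormD _ _) _; [exact: measurable_funB..|].
have -> : e%:E = (2%:E * (e / 4)%:E + 2%:E * (e / 4)%:E)%E.
  by rewrite -!EFinM -EFinD; congr EFin; field.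
by apply: lteD; rewrite lte_pmul2l.
Qed.

Lemma trig_approxD u v : measurable_fun setT u -> measurable_fun setT v ->
  trig_approx u -> trig_approx v -> trig_approx (u \+ v).
Proof.
move=> mu' mv au av e e0; have e4 : 0 < e / 4 by rewrite divr_gt0.
have [p tp up] := au _ e4; have [q tq vq] := av _ e4.
exists (fun t => p t + q t); first exact: trigpD.
have [mp _] := trigp_bounded_mfun tp; have [mq _] := trigp_bounded_mfun tq.
have -> : (u \+ v \- (fun t => p t + q t) = (u \- p) \+ (v \- q))%R.
  by apply/funext => t /=; rewrite opprD addrACA.
apply: le_lt_trans (sqnormD _ _) _; [exact: measurable_funB..|].
have -> : e%:E = (2%:E * (e / 4)%:E + 2%:E * (e / 4)%:E)%E.
  by rewrite -!EFinM -EFinD; congr EFin; field.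
by apply: lteD; rewrite lte_pmul2l.
Qed.

(** u v - p q = (u - p) v + (v - q) p, where the approximant q of v is chosen
    once p is known, because the accuracy that it needs depends on a bound of
    p. *)
Lemma trig_approxM u v : bounded_mfun u -> bounded_mfun v ->
  trig_approx u -> trig_approx v -> trig_approx (u \* v).
Proof.
move=> [mu' _] [mv [B vB]] au av e e0.
have B0 : 0 <= B by apply: le_trans (vB 0).
have [|p tp up] := au (e / (4 * (B ^+ 2 + 1))).
  by rewrite divr_gt0// mulr_gt0// ltr_wpDl ?sqr_ge0.
have [mp [A pA]] := trigp_bounded_mfun tp.
have A0 : 0 <= A by apply: le_trans (pA 0).
have [|q tq vq] := av (e / (4 * (A ^+ 2 + 1))).
  by rewrite divr_gt0// mulr_gt0// ltr_wpDl ?sqr_ge0.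
have [mq _] := trigp_bounded_mfun tq.
exists (fun t => p t * q t); first exact: trigpM.
have -> : (u \* v \- (fun t => p t * q t) = (u \- p) \* v \+ (v \- q) \* p)%R.
  by apply/funext => t /=; ring.
have bound (w z : R -> R) M : measurable_fun setT w -> measurable_fun setT z ->
    (forall t, `|z t| <= M) -> (sqnorm w < (e / (4 * (M ^+ 2 + 1)))%:E)%E ->
    (2%:E * sqnorm (w \* z)%R < (e / 2)%:E)%E.
  move=> mw mz zM wM; have M1 : 0 < M ^+ 2 + 1 by rewrite ltr_wpDl ?sqr_ge0.
  apply: (@le_lt_trans _ _ (2%:E * ((M ^+ 2)%:E * sqnorm w))%E).
    by rewrite lee_pmul2l //; exact: sqnormM.
  apply: (@le_lt_trans _ _ (2%:E * ((M ^+ 2 + 1)%:E * sqnorm w))%E).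
    rewrite lee_pmul2l // lee_wpmul2r ?lee_fin ?lerDl//.
    by apply: integral_ge0 => t _; rewrite lee_fin sqr_ge0.
  have -> : (e / 2)%:E = (2%:E * ((M ^+ 2 + 1)%:E * (e / (4 * (M ^+ 2 + 1)))%:E))%E.
    by rewrite -!EFinM; congr EFin; field; rewrite gt_eqF.
  by rewrite !lte_pmul2l.
apply: le_lt_trans (sqnormD _ _) _; [by apply: measurable_funM => //;
  exact: measurable_funB..|].
have -> : e%:E = ((e / 2)%:E + (e / 2)%:E)%E.
  by rewrite -EFinD; congr EFin; field.
by apply: lteD; apply: bound => //; exact: measurable_funB.
Qed.

(** Dominated convergence, applied to (u - u_k)^2, gives the approximants
    asked for by [trig_approx_closed]. *)
Lemma trig_approx_dominated (u_ : nat -> R -> R) u (G : R -> \bar R) :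
  (forall k, measurable_fun setT (u_ k)) -> measurable_fun setT u ->
  (forall k, trig_approx (u_ k)) ->
  {ae mu, forall t, u_ ^~ t @ \oo --> u t} ->
  mu.-integrable setT G ->
  {ae mu, forall t k, (((u t - u_ k t) ^+ 2)%:E <= G t)%E} ->
  trig_approx u.
Proof.
move=> mu_ mu' au cu iG uG; apply: trig_approx_closed => // e e0.
pose h k t := ((u t - u_ k t) ^+ 2)%:E.
have mh k : measurable_fun setT (h k).
  by apply: measurable_sqr; exact: measurable_funB.
have [] := @dominated_convergence _ _ _ mu setT measurableT h (cst 0%E) G.
- exact: mh.
- exact: measurable_cst.
- apply: ae_arcS cu => t ut _.
  have : (fun k => (u t - u_ k t) * (u t - u_ k t)) @ \oo -->
    (u t - u t) * (u t - u t).
    by apply: cvgM; apply: cvgB => //; exact: cvg_cst.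
  rewrite subrr mul0r => H; apply: cvg_EFin; first exact: nearW.
  apply: cvg_trans H; apply: near_eq_cvg; apply: nearW => k /=.
  by rewrite expr2.
- exact: iG.
- apply: ae_arcS uG => t utG k _; rewrite gee0_abs ?lee_fin ?sqr_ge0//; exact: utG.
move=> _ _; rewrite integral0 => /fine_cvgP[Hfin].
move=> /cvgr_lt /(_ _ e0) He.
near \oo => k.
exists (u_ k); split => //.
have : fine (\int[mu]_t h k t)%E < e by near: k; exact: He.
rewrite /sqnorm -lte_fin fineK //; near: k; exact: Hfin.
Unshelve. all: by end_near. Qed.

(** Newton's iteration for the sign. On [-1, 1] its fixed points are -1, 0 and
    1, and 0 is repelling, so that its iterates are odd polynomials converging
    to the sign. *)
Definition sign_step (y : R) := (3 * y - y ^+ 3) / 2.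

Lemma sign_stepN y : sign_step (- y) = - sign_step y.
Proof. by rewrite /sign_step; field. Qed.

Lemma iter_sign_stepN k y : iter k sign_step (- y) = - iter k sign_step y.
Proof. by elim: k => // k IH; rewrite !iterS IH sign_stepN. Qed.

(** With s for the iteration, 1 - s y = (1 - y)^2 (2 + y) / 2 <= (1 - y) (1 -
    y / 2) on ]0, 1], and the iterates increase: hence the geometric decay of
    the distance to 1. *)
Lemma iter_sign_step_gt0 k y : 0 < y <= 1 ->
  [/\ y <= iter k sign_step y, iter k sign_step y <= 1
    & 1 - iter k sign_step y <= (1 - y / 2) ^+ k].
Proof.
move=> /andP[y0 y1]; elim: k => [|k [IH1 IH2 IH3]].
  by rewrite /= expr0; split => //; lra.
rewrite iterS exprS; set z := iter k sign_step y in IH1 IH2 IH3 *.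
have z0 : 0 < z by lra.
rewrite /sign_step; split.
- suff : 0 <= z * (1 - z ^+ 2) by nra.
  by rewrite mulr_ge0 ?subr_ge0 ?expr_le1//; exact: ltW.
- suff : 0 <= (1 - z) ^+ 2 * (2 + z) by nra.
  by rewrite mulr_ge0 ?sqr_ge0//; lra.
- have -> : 1 - (3 * z - z ^+ 3) / 2 = (1 - z) * ((1 - z) * (2 + z) / 2) by field.
  rewrite mulrC; apply: ler_pM => //.
  + by rewrite divr_ge0// mulr_ge0//; lra.
  + by rewrite subr_ge0.
  + by nra.
Qed.

Lemma iter_sign_step_le1 k y : `|y| <= 1 -> `|iter k sign_step y| <= 1.
Proof.
have H z : 0 < z -> `|z| <= 1 -> `|iter k sign_step z| <= 1.
  move=> z0; rewrite (gtr0_norm z0) => z1.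
  have [|h1 h2 _] := @iter_sign_step_gt0 k z; first by rewrite z0.
  by rewrite ger0_norm// (le_trans _ h1)// ltW.
have [y0|y0|->] := ltgtP y 0; last 1 first.
- move=> _; suff -> : iter k sign_step 0 = 0 by rewrite normr0.
  by elim: (k) => // j IH; rewrite iterS IH /sign_step; ring.
- by move=> y1; rewrite -[y]opprK iter_sign_stepN normrN; apply: H;
  rewrite ?oppr_gt0// normrN.
- exact: H.
Qed.

Lemma cvg_iter_sign_step y : `|y| <= 1 ->
  iter k sign_step y @[k --> \oo] --> Num.sg y.
Proof.
have H z : 0 < z -> `|z| <= 1 -> iter k sign_step z @[k --> \oo] --> (1 : R).
  move=> z0; rewrite (gtr0_norm z0) => z1.
  have zP : 0 < z <= 1 by rewrite z0.
  apply: (@squeeze_cvgr _ _ _ _ (fun k => 1 - (1 - z / 2) ^+ k) (cst 1)).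
  - apply: nearW => k; have [_ h2 h3] := iter_sign_step_gt0 k zP.
    by rewrite h2 andbT lerBlDl -lerBlDr.
  - rewrite -[X in _ --> X]subr0; apply: cvgB; first exact: cvg_cst.
    apply: cvg_expr; rewrite ger0_norm; lra.
  - exact: cvg_cst.
have [y0|y0|->] := ltgtP y 0 => y1.
- rewrite ltr0_sg// -[y]opprK.
  under eq_fun do rewrite iter_sign_stepN.
  by apply: cvgN; apply: H; rewrite ?oppr_gt0// normrN.
- by rewrite gtr0_sg//; exact: H.
- rewrite sgr0 (_ : (fun k => _) = cst 0); first exact: cvg_cst.
  apply/funext => k /=; elim: k => // k IH.
  by rewrite iterS IH /sign_step; ring.
Qed.

Lemma trigp_iter_sign_step k p : trigp p -> trigp (fun t => iter k sign_step (p t)).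
Proof.
move=> tp; elim: k => // k IH.
set q := fun t => _ in IH.
have -> : (fun t => iter k.+1 sign_step (p t)) =
    (fun t => (3 / 2) * q t + (- (1/2)) * (q t * (q t * q t))).
  by apply/funext => t; rewrite iterS /sign_step /q; field.
apply: trigpD; apply: trigpM; try exact: trigp_cst; first exact: IH.
by apply: trigpM; last apply: trigpM.
Qed.

Lemma trigp_sin_shift x : trigp (fun t : R => sin (2 * pi * (t - x))).
Proof.
have -> : (fun t => sin (2 * pi * (t - x))) =
   (fun t => sin (2 * pi * t) * cos (2 * pi * x) + (- sin (2 * pi * x))
     * cos (2 * pi * t)).
  by apply/funext => t; rewrite mulrBr sinB mulNr [sin (_ * x) * _]mulrC.
apply: trigpD; apply: trigpM; try exact: trigp_cst.
- exact: trigp_sin.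
- exact: trigp_cos.
Qed.

Definition approx_set A := measurable A /\ trig_approx (\1_A : R -> R).

Definition half_circle x : set R := [set t | 0 < sin (2 * pi * (t - x))].

Lemma integrable_arc_cst c : mu.-integrable setT (EFin \o cst c).
Proof.
apply: measurable_bounded_integrable => //.
- by rewrite arcT ltry.
- exact: bounded_cst.
Qed.

(** The sign s of the sine is a bounded limit of trigonometric polynomials,
    and the indicator of the positive numbers is (s + s^2) / 2. *)
Lemma approx_set_half_circle x : approx_set (half_circle x).
Proof.
pose p t := sin (2 * pi * (t - x)).
have tp : trigp p := trigp_sin_shift x.
have p1 t : `|p t| <= 1 := sin_max _.
pose q k t := iter k sign_step (p t).
have q1 k t : `|q k t| <= 1 by exact: iter_sign_step_le1.
have mp : measurable_fun setT p by have [] := trigp_bounded_mfun tp.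
have mA : measurable (half_circle x).
  have -> : half_circle x = p @^-1` `]0, +oo[%classic.
    by apply/seteqP; split => t; rewrite /= in_itv /= andbT.
  by rewrite -[_ @^-1` _]setTI; exact: mp.
split => //.
pose w k t := (1/2) * (q k t + q k t * q k t).
have tw k : trigp (w k).
  apply: trigpM; first exact: trigp_cst.
  have tq : trigp (q k) := trigp_iter_sign_step k tp.
  by apply: trigpD => //; exact: trigpM.
have w1 k t : `|w k t| <= 1.
  by have := q1 k t; rewrite /w !ler_norml => /andP[h1 h2]; apply/andP; split; nra.
apply: (@trig_approx_dominated w _ (EFin \o cst 4)).
- by move=> k; have [] := trigp_bounded_mfun (tw k).
- exact: measurable_indic.
- by move=> k; exact: trig_approx_trigp.
- apply: aeW => t.
  have -> : \1_(half_circle x) t = (1/2) * (Num.sg (p t) + Num.sg (p t)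
    * Num.sg (p t)) :> R.
    rewrite indicE (_ : (t \in half_circle x) = (0 < p t)); last first.
      by apply/idP/idP; rewrite inE.
    by have [h|h|h] := ltgtP 0 (p t);
      [rewrite gtr0_sg//|rewrite ltr0_sg//|rewrite -h sgr0]; rewrite /=; field.
  have qc : (q ^~ t) @ \oo --> Num.sg (p t) by exact: cvg_iter_sign_step.
  apply: cvgM; first exact: cvg_cst.
  by apply: cvgD => //; exact: cvgM.
- exact: integrable_arc_cst.
- apply: aeW => t k; rewrite lee_fin.
  have := w1 k t; rewrite indicE; case: (_ \in _) => /=;
    rewrite ler_norml => /andP[h1 h2]; nra.
Qed.

Lemma trig_approx_cst c : trig_approx (fun=> c : R).
Proof. by apply: trig_approx_trigp; exact: trigp_cst. Qed.

Lemma bounded_indic A : measurable A -> bounded_mfun (\1_A : R -> R).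
Proof.
move=> mA; split; first exact: measurable_indic.
by exists 1 => t; rewrite indicE; case: (_ \in _); rewrite /= ?normr1 ?normr0.
Qed.

Lemma approx_setC A : approx_set A -> approx_set (~` A).
Proof.
move=> [mA aA]; split; first exact: measurableC.
have -> : \1_(~` A) = ((fun=> 1) \+ ((fun=> -1) \* \1_A) : R -> R).
  apply/funext => t /=; rewrite !indicE in_setC.
  by case: (_ \in _) => /=; ring.
apply: trig_approxD.
- exact: measurable_cst.
- by apply: measurable_funM; [exact: measurable_cst|exact: measurable_indic].
- exact: trig_approx_cst.
- apply: trig_approxM => //; first exact: bounded_mfun_cst.
  + exact: bounded_indic.
  + exact: trig_approx_cst.
Qed.

Lemma approx_setI A B : approx_set A -> approx_set B -> approx_set (A `&` B).
Proof.
move=> [mA aA] [mB aB]; split; first exact: measurableI.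
have -> : \1_(A `&` B) = (\1_A \* \1_B : R -> R) by rewrite indicI.
by apply: trig_approxM => //; exact: bounded_indic.
Qed.

Lemma approx_setU A B : approx_set A -> approx_set B -> approx_set (A `|` B).
Proof.
move=> hA hB; rewrite -[A `|` B]setCK setCU.
by apply: approx_setC; apply: approx_setI; exact: approx_setC.
Qed.

Lemma approx_set_ae A B : measurable A -> approx_set B ->
  {ae mu, forall t, A t <-> B t} -> approx_set A.
Proof.
move=> mA [mB aB] AB; split => //.
apply: (@trig_approx_dominated (fun=> \1_B) _ (EFin \o cst 0)).
- by move=> _; exact: measurable_indic.
- exact: measurable_indic.
- by [].
- apply: ae_arcS AB => t AB; rewrite (_ : \1_A t = \1_B t :> R);
  first exact: cvg_cst.
  rewrite !indicE; congr ((nat_of_bool _)%:R); apply/idP/idP; rewrite !inE => ?;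
    exact/AB.
- exact: integrable_arc_cst.
- apply: ae_arcS AB => t AB _; rewrite (_ : \1_A t = \1_B t :> R).
    by rewrite subrr expr0n.
  rewrite !indicE; congr ((nat_of_bool _)%:R); apply/idP/idP; rewrite !inE => ?;
    exact/AB.
Qed.

(** Finite unions are dealt with by the algebra of approximable functions, and
    their indicators converge to that of the whole union. *)
Lemma approx_set_bigcup (F : (set R)^nat) :
  (forall k, approx_set (F k)) -> approx_set (\bigcup_k F k).
Proof.
move=> aF; have mF k : measurable (F k) by have [] := aF k.
pose G k := \big[setU/set0]_(i < k) F i.
have aG k : approx_set (G k).
  rewrite /G; elim: k => [|k IH]; last by rewrite big_ord_recr /=;
    exact: approx_setU.
  rewrite big_ord0; split; first exact: measurable0.
  by rewrite indic0; exact: trig_approx_cst.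
split; first exact: bigcup_measurable.
apply: (@trig_approx_dominated (fun k => \1_(G k)) _ (EFin \o cst 1)).
- by move=> k; have [mG _] := aG k; exact: measurable_indic.
- by apply: measurable_indic; exact: bigcup_measurable.
- by move=> k; have [] := aG k.
- apply: aeW => t.
  have [[i _ Fit]|nF] := pselect ((\bigcup_k F k) t).
    apply: cvg_near_cst; exists i.+1 => // k /= ik.
    have h1 : (\bigcup_k F k) t by exists i.
    have h2 : G k t by rewrite /G -bigcup_mkord; exists i.
    by rewrite !indicE (mem_set h1) (mem_set h2).
  apply: cvg_near_cst; apply: nearW => k /=.
  have h2 : ~ G k t by rewrite /G -bigcup_mkord => -[i _ Fit]; apply: nF; exists i.
  by rewrite !indicE (memNset nF) (memNset h2).
- exact: integrable_arc_cst.
- apply: aeW => t k; rewrite lee_fin !indicE.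
  by case: (_ \in _); case: (_ \in _) => /=; lra.
Qed.

Lemma ae_arc_itv : {ae mu, forall t, 0 <= t <= 1}.
Proof.
exists (~` `[0, 1]%classic); split.
- by apply: measurableC; exact: measurable_itv.
- by rewrite /Defs.arc /= /mrestr setICl measure0.
- by move=> t; rewrite /= in_itv /=.
Qed.

Lemma ae_arc_neq c : {ae mu, forall t, t != c}.
Proof.
exists [set c]; split.
- exact: measurable_set1.
- apply/eqP; rewrite -measure_le0 /Defs.arc /= /mrestr.
  apply: (@le_trans _ _ (@lebesgue_measure R [set c])).
    by apply: le_measure; rewrite ?inE//; apply: measurableI => //;
      exact: measurable_itv.
  by rewrite lebesgue_measure_set1.
- by move=> t; rewrite /= => /negP; rewrite negbK => /eqP.
Qed.

Lemma sin2pi_gt0 (t : R) : 0 < t < 1 / 2 -> 0 < sin (2 * pi * t).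
Proof.
move=> /andP[t0 t1]; apply: sin_gt0_pi; have := pi_gt0 R => ppi.
by rewrite mulr_gt0 ?mulr_gt0//=; nra.
Qed.

Lemma sin2pi_lt0 (t : R) : - (1 / 2) < t < 0 -> sin (2 * pi * t) < 0.
Proof.
move=> /andP[t0 t1]; rewrite -[t]opprK mulrN sinN oppr_lt0; apply: sin2pi_gt0.
lra.
Qed.

Lemma sin2pi_le0 (t : R) : - (1 / 2) < t <= 0 \/ 1 / 2 <= t < 1 ->
  sin (2 * pi * t) <= 0.
Proof.
case=> /andP[t0 t1].
  have [->|tn0] := eqVneq t 0; first by rewrite mulr0 sin0.
  by apply/ltW/sin2pi_lt0; rewrite t0 lt_neqAle tn0.
have -> : 2 * pi * t = 2 * pi * (t - 1 / 2) + pi by field.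
rewrite sinDpi oppr_le0.
have [->|tn0] := eqVneq t (1 / 2); first by rewrite subrr mulr0 sin0.
apply/ltW/sin2pi_gt0; rewrite subr_gt0 lt_neqAle eq_sym tn0 t0 /=; lra.
Qed.

(** For x < 1/2 the half circle starting at x stops at x + 1/2, and the lower
    half circle completes it up to 1. For x >= 1/2 it wraps around 1, and the
    part beyond 1 is removed by intersecting with the lower half circle. *)
Lemma approx_set_ray x : approx_set `]x, +oo[%classic.
Proof.
have aH0 := approx_setC (approx_set_half_circle 0).
have aHx := approx_set_half_circle x.
have mI : measurable (`]x, +oo[%classic : set R) by exact: measurable_itv.
have ae01 : {ae mu, forall t, 0 < t < 1}.
  apply: ae_arcS (ae_arcI ae_arc_itv (ae_arcI (ae_arc_neq 0) (ae_arc_neq 1))).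
  by move=> t [/andP[t0 t1] [n0 n1]]; rewrite !lt_neqAle t0 t1 n1 eq_sym n0.
have H0E t : (~` half_circle 0) t <-> sin (2 * pi * t) <= 0.
  by rewrite /half_circle /= subr0; split=> [/negP|h]; rewrite -?leNgt//;
    apply/negP; rewrite -leNgt.
have HxE t : half_circle x t <-> 0 < sin (2 * pi * (t - x)) by [].
have RE t : `]x, +oo[%classic t <-> x < t by rewrite /= in_itv /= andbT.
have [x0|x0] := ltP x 0.
  apply: (@approx_set_ae _ setT) => //.
    by split => //; rewrite indicT; exact: trig_approx_cst.
  by apply: ae_arcS ae01 => t t01; rewrite RE; split => // _; lra.
have [x1|x1] := leP 1 x.
  apply: (@approx_set_ae _ set0) => //.
    by split => //; rewrite indic0; exact: trig_approx_cst.
  by apply: ae_arcS ae01 => t t01; rewrite RE; split => // h; lra.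
have [xh|xh] := ltP x (1 / 2).
  apply: (approx_set_ae mI (approx_setU aHx aH0)).
  apply: ae_arcS ae01 => t t01; rewrite RE; split => [xt|[/HxE|/H0E]].
  - have [th|th] := ltP t (1 / 2).
      by left; apply/HxE; apply: sin2pi_gt0; lra.
    by right; apply/H0E; apply: sin2pi_le0; right; lra.
  - apply: contraTT; rewrite -!leNgt => tx; apply: sin2pi_le0; left; lra.
  - by apply: contraTT; rewrite -leNgt -ltNge => tx; apply: sin2pi_gt0; lra.
apply: (approx_set_ae mI (approx_setI aHx aH0)).
apply: ae_arcS ae01 => t t01; rewrite RE; split => [xt|[/HxE h /H0E]].
- split; first by apply/HxE; apply: sin2pi_gt0; lra.
  by apply/H0E; apply: sin2pi_le0; right; lra.
- apply: contraTT; rewrite -leNgt -ltNge => tx; apply: sin2pi_gt0.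
  have [h2|h2] := ltP t (1 / 2); first lra.
  have : sin (2 * pi * (t - x)) <= 0 by apply: sin2pi_le0; left; lra.
  by move: h; rewrite ltNge => /negP.
Qed.

(** The approximable sets form a sigma-algebra containing the rays. *)
Lemma approx_set_measurable A :
  measurable (A : set (measurableTypeR R)) -> approx_set A.
Proof.
rewrite (RGenOInfty.measurableE R).
apply: smallest_sub; last by move=> _ [x ->]; exact: approx_set_ray.
split.
- by split => //; rewrite indic0; exact: trig_approx_cst.
- by move=> B aB; rewrite setTD; exact: approx_setC.
- exact: approx_set_bigcup.
Qed.

Lemma trig_approx_nnsfun (f : {nnsfun measurableTypeR R >-> R}) :
  trig_approx (f : R -> R).
Proof.
pose F := fun y : R => (fun t => y * \1_(f @^-1` [set y]) t) : R -> R.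
have mfy y : measurable (f @^-1` [set y] : set (measurableTypeR R))
  by exact: measurable_sfunP.
have bfy y : bounded_mfun (\1_(f @^-1` [set y]) : R -> R) := bounded_indic (mfy y).
have mF y : bounded_mfun (F y).
  by apply: bounded_mfunM => //; exact: bounded_mfun_cst.
have aF y : trig_approx (F y).
  apply: trig_approxM; [exact: bounded_mfun_cst| |exact: trig_approx_cst|] => //.
  by have [] := approx_set_measurable (mfy y).
have S s : bounded_mfun (fun t => \sum_(y <- s) F y t) /\
    trig_approx (fun t => \sum_(y <- s) F y t).
  elim: s => [|y s [IH1 IH2]].
    rewrite (_ : (fun t => _) = (fun=> 0)); last by apply/funext => t;
      rewrite big_nil.
    by split; [exact: bounded_mfun_cst|exact: trig_approx_cst].
  rewrite (_ : (fun t => _) = (fun t => F y t + \sum_(z <- s) F z t)); last first.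
    by apply/funext => t; rewrite big_cons.
  split; first exact: bounded_mfunD.
  by apply: trig_approxD; [have [] := mF y|have [] := IH1|exact: aF|exact: IH2].
rewrite (_ : (f : R -> R) =
    (fun t => \sum_(y <- finmap.enum_fset (fset_set (range f))) F y t)).
  by have [] := S (finmap.enum_fset (fset_set (range f))).
by apply/funext => t; rewrite fimfunE fsbig_finite.
Qed.

(** Simple functions w increase to u, and (u - w)^2 <= u^2. *)
Lemma trig_approx_ge0 u : measurable_fun setT u -> (forall t, 0 <= u t) ->
  mu.-integrable setT (fun t => (u t ^+ 2)%:E) -> trig_approx u.
Proof.
move=> mu' u0 iu.
have meu : measurable_fun setT (EFin \o u) by exact/measurable_EFinP.
pose w k : {nnsfun measurableTypeR R >-> R} :=
  @nnsfun_approx _ (measurableTypeR R) R setT measurableT (EFin \o u) meu k.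
have wc t : w ^~ t @ \oo --> u t.
  have := @cvg_nnsfun_approx _ (measurableTypeR R)
    _ setT measurableT _ meu (fun x _ => u0 x) t Logic.I.
  by move/fine_cvgP => [_].
apply: (@trig_approx_dominated (fun k => w k : R ->
  R) u (fun t => (u t ^+ 2)%:E)) => //.
- by move=> k; exact: (@measurable_funPT _ _ (measurableTypeR R) _ (w k)).
- by move=> k; exact: (trig_approx_nnsfun (w k)).
- exact: aeW.
- apply: aeW => t k; rewrite lee_fin.
  have wu : w k t <= u t.
    have nd := @nd_nnsfun_approx _ (measurableTypeR R) _ setT measurableT _ meu.
    have : {homo w ^~ t : n m / (n <= m)%N >-> n <= m}.
      by move=> n m nm; have /lefP := nd n m nm; exact.
    move/nondecreasing_cvgn_le => /(_ (cvgP _ (wc t)) k).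
    by rewrite (cvg_lim _ (wc t)).
  have w0 : 0 <= w k t by [].
  by rewrite lerXn2r ?nnegrE// ?subr_ge0// ?gerBl.
Qed.

Lemma trig_approx_L2 u : measurable_fun setT u ->
  mu.-integrable setT (fun t => (u t ^+ 2)%:E) -> trig_approx u.
Proof.
move=> mu' iu.
have part v : measurable_fun setT v -> (forall t, 0 <= v t <= `|u t|) ->
  trig_approx v.
  move=> mv vu; apply: trig_approx_ge0 => //; first by move=> t; have /andP[] :=
    vu t.
  apply: le_integrable iu => //; first exact: measurable_sqr.
  move=> t _; rewrite !gee0_abs ?lee_fin ?sqr_ge0//.
  have /andP[v0 vut] := vu t.
  by rewrite -(real_normK (num_real (u t))) lerXn2r ?nnegrE.
have mp : measurable_fun setT (fun t => (`|u t| + u t) / 2).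
  apply: measurable_funM; last exact: measurable_cst.
  by apply: measurable_funD => //; exact: measurableT_comp.
have mn : measurable_fun setT (fun t => (`|u t| - u t) / 2).
  apply: measurable_funM; last exact: measurable_cst.
  by apply: measurable_funB => //; exact: measurableT_comp.
have -> : u = ((fun t => (`|u t| + u t) / 2) \+ (fun=> -1)
  \* (fun t => (`|u t| - u t) / 2))%R.
  by apply/funext => t /=; field.
apply: trig_approxD => //.
- by apply: measurable_funM => //; exact: measurable_cst.
- apply: part => // t; have := ler_norm (u t); have := ler_norm (- u t).
  by rewrite normrN => h1 h2; apply/andP; split; lra.
- have : trig_approx (fun t => (`|u t| - u t) / 2).
    apply: part => // t; have := ler_norm (u t); have := ler_norm (- u t).
    by rewrite normrN => h1 h2; apply/andP; split; lra.
  move=> H e e0; have [p tp hp] := H e e0.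
  exists (fun t => -1 * p t); first by apply: trigpM => //; exact: trigp_cst.
  rewrite (_ : sqnorm _ = sqnorm ((fun t => (`|u t| - u t) / 2) \- p)) //.
  by apply: eq_integral => t _ /=; congr EFin; ring.
Qed.

End TrigonometricDensity.

(** * Complex functions on the circle *)

Lemma le1_2 (R : realType) : (1 <= 2%:E :> \bar R)%E.
Proof. by rewrite lee_fin lerDl. Qed.

Lemma le1_oo (R : realType) : (1 <= +oo :> \bar R)%E.
Proof. exact: leey. Qed.

#[local] Hint Resolve le1_2 le1_oo : core.

Section ComplexFunctions.
Context {R : realType}.
Notation mu := (Defs.arc R).
Notation C := R[i].
Notation Re := complex.Re.
Notation Im := complex.Im.
Implicit Types (x y c : C) (f g h : C -> C).

Lemma ReD x y : Re (x + y) = Re x + Re y. Proof. by case: x y => [a b] []. Qed.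
Lemma ImD x y : Im (x + y) = Im x + Im y. Proof. by case: x y => [a b] []. Qed.
Lemma ReN x : Re (- x) = - Re x. Proof. by case: x. Qed.
Lemma ImN x : Im (- x) = - Im x. Proof. by case: x. Qed.
Lemma ReM x y : Re (x * y) = Re x * Re y - Im x * Im y.
Proof. by case: x y => [a b] []. Qed.
Lemma ImM x y : Im (x * y) = Re x * Im y + Im x * Re y.
Proof. by case: x y => [a b] []. Qed.
Lemma ReJ x : Re x^* = Re x. Proof. by case: x. Qed.
Lemma ImJ x : Im x^* = - Im x. Proof. by case: x. Qed.
Definition ReImE := (ReD, ImD, ReN, ImN, ReM, ImM, ReJ, ImJ).

Lemma complex_eqP x y : Re x = Re y -> Im x = Im y -> x = y.
Proof. by case: x y => [a b] [c d] /= -> ->. Qed.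

(** The square of the modulus, as a real number: the norm of [R[i]] takes
    complex values, to which real integrals and real bounds do not apply. *)
Definition sqabs x : R := Re x ^+ 2 + Im x ^+ 2.

Lemma sqabs_ge0 x : 0 <= sqabs x. Proof. by rewrite addr_ge0 ?sqr_ge0. Qed.
Lemma sqabsM x y : sqabs (x * y) = sqabs x * sqabs y.
Proof. by rewrite /sqabs !ReImE; ring. Qed.
Lemma mulCJ x : x * x^* = (sqabs x)%:C%C.
Proof. by apply: complex_eqP; rewrite /sqabs !ReImE /=; ring. Qed.
Lemma sqabs_eq0 x : (sqabs x == 0) = (x == 0).
Proof.
rewrite paddr_eq0 ?sqr_ge0// !sqrf_eq0; case: x => a b /=.
by rewrite eq_complex.
Qed.
Lemma normc_sqr x : Normc.normc x ^+ 2 = sqabs x.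
Proof. by case: x => a b; rewrite /= sqr_sqrtr// addr_ge0 ?sqr_ge0. Qed.

Lemma sqabs_cis t : sqabs (cis t : C) = 1.
Proof. by rewrite /sqabs /= cos2Dsin2. Qed.
Lemma cis_neq0 t : cis t != 0 :> C.
Proof. by rewrite -sqabs_eq0 sqabs_cis oner_eq0. Qed.
Lemma cisJ t : (cis t : C)^* = (cis t)^-1.
Proof.
apply: (mulfI (cis_neq0 t)); rewrite mulfV ?cis_neq0// mulCJ sqabs_cis.
by [].
Qed.
Lemma cisXJ t (k : int) : ((cis t : C) ^ k)^* = (cis t) ^ (- k).
Proof. by rewrite rmorphXz ?unitfE ?cis_neq0//= cisJ exprz_inv. Qed.
Lemma sqabs1 : sqabs 1 = 1. Proof. by rewrite /sqabs /= expr1n expr0n addr0. Qed.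
Lemma sqabs_cisX t (k : int) : sqabs ((cis t : C) ^ k) = 1.
Proof.
have /(congr1 (fun x : C => Re x)) := mulCJ ((cis t : C) ^ k).
rewrite cisXJ -expfzDr ?cis_neq0// subrr expr0z /= => <-.
by [].
Qed.

Lemma aeTW (P : C -> Prop) : (forall t, P (cis t)) -> aeT P.
Proof. by move=> h; rewrite /aeT; apply: aeW. Qed.

Lemma aeTS (P Q : C -> Prop) : (forall t, P (cis t) -> Q (cis t)) -> aeT P -> aeT Q.
Proof. by move=> h; exact: (ae_arcS h). Qed.

Lemma aeTI (P Q : C -> Prop) : aeT P -> aeT Q -> aeT (fun z => P z /\ Q z).
Proof. by rewrite /aeT => h1 h2; exact: ae_arcI. Qed.

Lemma aeT_forall (I : finType) (P : I -> C -> Prop) :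
  (forall i, aeT (P i)) -> aeT (fun z => forall i, P i z).
Proof.
by move=> aP; have F := ae_filter_ringOfSetsType mu; exact: filter_forall.
Qed.

Lemma aeT_ex (P : C -> Prop) : aeT P -> exists t, P (cis t).
Proof.
move=> aP; have F : ProperFilter (almost_everywhere mu).
  by apply: ae_properfilter_algebraOfSetsType; rewrite arcT.
by have := @filter_ex _ _ F _ aP.
Qed.

Definition measT f :=
  measurable_fun setT (fun t => Re (f (cis t))) /\
  measurable_fun setT (fun t => Im (f (cis t))).

Lemma eq_measT f g : (forall t, f (cis t) = g (cis t)) -> measT f -> measT g.
Proof. by move=> fg [m1 m2]; split; [move: m1|move: m2];
  apply: eq_measurable_fun => t _; rewrite fg. Qed.

Lemma LT_meas p f : LT p f -> measT f.
Proof.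
by move=> [/andP[+ _] /andP[+ _]]; rewrite !inE.
Qed.

Lemma eq_LT p f g : (forall t, f (cis t) = g (cis t)) -> LT p f -> LT p g.
Proof.
move=> fg; rewrite /LT.
rewrite (_ : (fun t => Re (f (cis t))) = (fun t => Re (g (cis t)))); last first.
  by apply/funext => t; rewrite fg.
rewrite (_ : (fun t => Im (f (cis t))) = (fun t => Im (g (cis t)))) //.
by apply/funext => t; rewrite fg.
Qed.

Lemma eq_intT f g : (forall t, f (cis t) = g (cis t)) -> intT f = intT g.
Proof. by move=> fg; rewrite /intT; congr Complex; apply: eq_Rintegral => t _;
  rewrite fg. Qed.

Lemma measT_cst c : measT (fun=> c).
Proof. by split; exact: measurable_cst. Qed.

Lemma measTD f g : measT f -> measT g -> measT (fun z => f z + g z).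
Proof.
move=> [f1 f2] [g1 g2]; split.
- rewrite (_ : (fun t => _) = (fun t => Re (f (cis t)) + Re (g (cis t)))).
    exact: measurable_funD.
  by apply/funext => t; rewrite ReD.
- rewrite (_ : (fun t => _) = (fun t => Im (f (cis t)) + Im (g (cis t)))).
    exact: measurable_funD.
  by apply/funext => t; rewrite ImD.
Qed.

Lemma measTM f g : measT f -> measT g -> measT (fun z => f z * g z).
Proof.
move=> [f1 f2] [g1 g2]; split.
- rewrite (_ : (fun t => _) = (fun t => Re (f (cis t)) * Re (g (cis t)) -
    Im (f (cis t)) * Im (g (cis t)))).
    by apply: measurable_funB; exact: measurable_funM.
  by apply/funext => t; rewrite ReM.
- rewrite (_ : (fun t => _) = (fun t => Re (f (cis t)) * Im (g (cis t)) +
    Im (f (cis t)) * Re (g (cis t)))).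
    by apply: measurable_funD; exact: measurable_funM.
  by apply/funext => t; rewrite ImM.
Qed.

Lemma measTJ f : measT f -> measT (fun z => (f z)^*).
Proof.
move=> [f1 f2]; split.
- by rewrite (_ : (fun t => _) = (fun t => Re (f (cis t)))) //;
  apply/funext => t; rewrite ReJ.
- rewrite (_ : (fun t => _) = (fun t => - Im (f (cis t)))).
    exact: measurableT_comp.
  by apply/funext => t; rewrite ImJ.
Qed.

Lemma measT_sum (I : Type) (s : seq I) (F : I -> C -> C) :
  (forall i, measT (F i)) -> measT (fun z => \sum_(i <- s) F i z).
Proof.
move=> mF; elim: s => [|i s IH].
  by apply: (@eq_measT (fun=> 0)) => [t|]; [rewrite big_nil|exact: measT_cst].
apply: (@eq_measT (fun z => F i z + \sum_(j <- s) F j z)) => [t|].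
  by rewrite big_cons.
exact: measTD.
Qed.

Lemma measT_id : measT id.
Proof. by split; [exact: measurable_cos2pi|exact: measurable_sin2pi]. Qed.

Lemma measT_horner (p : {poly C}) : measT (fun z => p.[z]).
Proof.
elim/poly_ind: p => [|p c IH].
  by apply: (@eq_measT (fun=> 0)) => [t|]; [rewrite horner0|exact: measT_cst].
apply: (@eq_measT (fun z => p.[z] * z + c)) => [t|].
  by rewrite hornerMXaddC.
by apply: measTD; [apply: measTM => //; exact: measT_id|exact: measT_cst].
Qed.

Lemma measT_exprz (k : int) : measT (fun z => z ^ k).
Proof.
have H n : measT (fun z => z ^+ n).
  by apply: (@eq_measT (fun z => ('X^n).[z])) => [t|];
    [rewrite hornerXn|exact: measT_horner].
case: k => n; first exact: H.
apply: (@eq_measT (fun z => (z ^+ n.+1)^*)) => [t|]; last exact: measTJ.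
by have := cisXJ t n.+1; rewrite NegzE.
Qed.

Lemma measT_sqabs f : measT f -> measurable_fun setT (fun t => sqabs (f (cis t))).
Proof. by move=> [f1 f2]; apply: measurable_funD; exact: measurable_funX. Qed.

Lemma LfunD (p : \bar R) (u v : R -> R) : (1 <= p)%E ->
  u \in Lfun mu p -> v \in Lfun mu p -> (fun t => u t + v t) \in Lfun mu p.
Proof. by move=> p1 hu hv; exact: (Lfun_addr_closed mu p1).2. Qed.

Lemma LfunZ (p : \bar R) (a : R) (u : R -> R) : (1 <= p)%E ->
  u \in Lfun mu p -> (fun t => a * u t) \in Lfun mu p.
Proof.
move=> p1 hu; have [h0 hZ] := Lfun_submod_closed mu p1.
have := hZ a u 0 hu h0; rewrite (_ : _ + 0 = (fun t => a * u t))//.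
by apply/funext => t /=; rewrite addr0.
Qed.

Lemma LTD p f g : (1 <= p)%E -> LT p f -> LT p g -> LT p (fun z => f z + g z).
Proof.
move=> p1 [f1 f2] [g1 g2]; split.
- rewrite (_ : (fun t => _) = (fun t => Re (f (cis t)) + Re (g (cis t))));
  first exact: LfunD.
  by apply/funext => t; rewrite ReD.
- rewrite (_ : (fun t => _) = (fun t => Im (f (cis t)) + Im (g (cis t))));
  first exact: LfunD.
  by apply/funext => t; rewrite ImD.
Qed.

Lemma LTZ p c f : (1 <= p)%E -> LT p f -> LT p (fun z => c * f z).
Proof.
move=> p1 [f1 f2]; split.
- rewrite (_ : (fun t => _) = (fun t => Re c * Re (f (cis t)) + (- Im c)
  * Im (f (cis t)))).
    by apply: LfunD => //; exact: LfunZ.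
  by apply/funext => t; rewrite ReM mulNr.
- rewrite (_ : (fun t => _) = (fun t => Re c * Im (f (cis t))
  + Im c * Re (f (cis t)))).
    by apply: LfunD => //; exact: LfunZ.
  by apply/funext => t; rewrite ImM.
Qed.

Lemma LTJ p f : (1 <= p)%E -> LT p f -> LT p (fun z => (f z)^*).
Proof.
move=> p1 [f1 f2]; split.
- by rewrite (_ : (fun t => _) = (fun t => Re (f (cis t)))) //;
  apply/funext => t; rewrite ReJ.
- rewrite (_ : (fun t => _) = (fun t => (-1) * Im (f (cis t)))).
    exact: LfunZ.
  by apply/funext => t; rewrite ImJ mulN1r.
Qed.

Lemma bounded_Lfun_oo (u : R -> R) M : measurable_fun setT u ->
  {ae mu, forall t, `|u t| <= M} -> u \in Lfun mu +oo%E.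
Proof.
move=> mu' uM; rewrite inE; apply/andP; split; first by rewrite inE.
rewrite inE /= /finite_norm unlock /Lnorm arcT lte_fin ltr01.
apply: (@le_lt_trans _ _ M%:E); last exact: ltry.
by apply/ess_supP; apply: ae_arcS uM => t /=; rewrite lee_fin.
Qed.

Lemma Lfun_oo_bounded (u : R -> R) : u \in Lfun mu +oo%E ->
  exists M, {ae mu, forall t, `|u t| <= M}.
Proof.
rewrite inE => /andP[/[!inE]/= mu'];
  rewrite /finite_norm unlock /Lnorm arcT lte_fin ltr01.
by move=> /ess_supr_bounded[M uM]; exists M.
Qed.

(** The spaces [LT p] are defined by real and imaginary parts, whereas
    estimates of products bear on the modulus; likewise for [LT_2P]. *)
Lemma LT_ooP f : LT +oo%E f <->
  measT f /\ exists M, aeT (fun z => sqabs (f z) <= M).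
Proof.
split=> [Lf|[[m1 m2] [M fM]]].
  split; first exact: LT_meas Lf.
  have [/Lfun_oo_bounded[A fA] /Lfun_oo_bounded[B fB]] := Lf.
  exists (A ^+ 2 + B ^+ 2); apply: ae_arcS (ae_arcI fA fB) => t [tA tB].
  have s (x y : R) : `|x| <= y -> x ^+ 2 <= y ^+ 2.
    by move=> xy; rewrite -(real_normK (num_real x))
      lerXn2r ?nnegrE// (le_trans _ xy).
  by apply: lerD; exact: s.
have b (a d : R) : a ^+ 2 + d ^+ 2 <= M -> `|a| <= M + 1.
  by move=> h; rewrite ler_norml; have := sqr_ge0 d; have := sqr_ge0 (a - 1);
    have := sqr_ge0 (a + 1) => *; apply/andP; split; nra.
split; apply: (@bounded_Lfun_oo _ (M + 1)) => //; apply: ae_arcS fM => t.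
  exact: b.
by rewrite /sqabs addrC; exact: b.
Qed.

Lemma LT_2P f : LT 2%:E f <->
  measT f /\ mu.-integrable setT (fun t => (sqabs (f (cis t)))%:E).
Proof.
split=> [Lf|[mf sf]].
  split; first exact: LT_meas Lf.
  have [/Lfun2_integrable_sqr i1 /Lfun2_integrable_sqr i2] := Lf.
  have := integrableD measurableT i1 i2.
  by apply: eq_integrable => // t _; rewrite /= -EFinD.
have h (u : R -> R) : measurable_fun setT u ->
    (forall t, u t ^+ 2 <= sqabs (f (cis t))) -> u \in Lfun mu 2%:E.
  move=> mu' us; rewrite inE; apply/andP; split; first by rewrite inE.
  rewrite inE /= /finite_norm unlock /Lnorm; apply: poweR_lty.
  have /integrableP[_] := sf; apply: le_lt_trans.
  apply: ge0_le_integral => //.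
  - by move=> t _; rewrite poweR_ge0.
  - apply: (@eq_measurable_fun _ _ _ _ _ (fun t => (u t ^+ 2)%:E)).
      move=> t _ /=; rewrite powR_mulrn // -normrX ger0_norm ?sqr_ge0//.
    exact: measurable_sqr.
  - by apply: measurableT_comp => //; apply/measurable_EFinP; exact: measT_sqabs.
  - move=> t _ /=; rewrite powR_mulrn // -normrX lee_fin !ger0_norm ?sqr_ge0
    ?sqabs_ge0//.
have [m1 m2] := mf.
by split; apply: h => // t; rewrite ?lerDl ?lerDr sqr_ge0.
Qed.

Lemma LT2M f g : LT 2%:E f -> LT 2%:E g -> LT 1%E (fun z => f z * g z).
Proof.
move=> [f1 f2] [g1 g2]; split.
- rewrite (_ : (fun t => _) = (fun t => Re (f (cis t)) * Re (g (cis t)) +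
    (-1) * (Im (f (cis t)) * Im (g (cis t))))); last first.
    by apply/funext => t; rewrite ReM mulN1r.
  by apply: LfunD => //; last apply: LfunZ => //; exact: Lfun2_mul_Lfun1.
- rewrite (_ : (fun t => _) = (fun t => Re (f (cis t)) * Im (g (cis t)) +
    (Im (f (cis t)) * Re (g (cis t))))); last first.
    by apply/funext => t; rewrite ImM.
  by apply: LfunD => //; exact: Lfun2_mul_Lfun1.
Qed.

Lemma LTooM f g : LT +oo%E f -> LT 2%:E g -> LT 2%:E (fun z => f z * g z).
Proof.
move=> /LT_ooP[mf [M fM]] /LT_2P[mg ig]; apply/LT_2P.
have mfg := measTM mf mg; split => //.
apply/integrableP; split; first by apply/measurable_EFinP; exact: (measT_sqabs mfg).
have /integrableP[_] := integrableZl measurableT M ig.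
apply: le_lt_trans; apply: ae_ge0_le_integral => //.
- by apply: measurableT_comp => //; apply/measurable_EFinP;
  exact: (measT_sqabs mfg).
- apply: measurableT_comp => //; apply: measurable_funeM.
  by apply/measurable_EFinP; exact: (measT_sqabs mg).
- apply: ae_arcS fM => t ft _; rewrite /= lee_fin sqabsM.
  have M0 : 0 <= M by apply: le_trans ft; exact: sqabs_ge0.
  by rewrite !ger0_norm ?mulr_ge0 ?sqabs_ge0// ler_wpM2r ?sqabs_ge0.
Qed.

Lemma LToo_cst c : LT +oo%E (fun=> c).
Proof.
apply/LT_ooP; split; first exact: measT_cst.
by exists (sqabs c); exact: aeTW.
Qed.

Lemma LToo_exprz (k : int) : LT +oo%E (fun z : C => z ^ k).
Proof.
apply/LT_ooP; split; first exact: measT_exprz.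
by exists 1; apply: aeTW => t; rewrite sqabs_cisX.
Qed.

Lemma LT2_cst c : LT 2%:E (fun=> c).
Proof.
apply/LT_2P; split; first exact: measT_cst.
exact: integrable_arc_cst.
Qed.

Lemma LToo_LT2 f : LT +oo%E f -> LT 2%:E f.
Proof.
move=> Lf; apply: (@eq_LT _ (fun z => f z * 1)) => [t|]; first by rewrite mulr1.
by apply: LTooM => //; exact: LT2_cst.
Qed.

Lemma LT2_LT1 f : LT 2%:E f -> LT 1%E f.
Proof.
move=> Lf; apply: (@eq_LT _ (fun z => f z * 1)) => [t|]; first by rewrite mulr1.
by apply: LT2M => //; exact: LT2_cst.
Qed.

Lemma LT2_ae f g : measT g -> aeT (fun z => f z = g z) -> LT 2%:E f -> LT 2%:E g.
Proof.
move=> mg fg /LT_2P[mf iF]; apply/LT_2P; split => //.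
apply/integrableP; split; first by apply/measurable_EFinP; exact: (measT_sqabs mg).
have /integrableP[_] := iF; apply: le_lt_trans; apply: ae_ge0_le_integral => //.
- by apply: measurableT_comp => //; apply/measurable_EFinP; exact: (measT_sqabs mg).
- by apply: measurableT_comp => //; apply/measurable_EFinP; exact: (measT_sqabs mf).
- by apply: ae_arcS fg => t -> _.
Qed.

Lemma LT_sum p (I : Type) (s : seq I) (F : I -> C -> C) : (1 <= p)%E ->
  (forall i, LT p (F i)) -> LT p (fun z => \sum_(i <- s) F i z).
Proof.
move=> p1 mF; elim: s => [|i s IH].
  apply: (@eq_LT _ (fun=> 0)) => [t|]; first by rewrite big_nil.
  by have [h _] := Lfun_submod_closed mu p1; split.
apply: (@eq_LT _ (fun z => F i z + \sum_(j <- s) F j z)) => [t|].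
  by rewrite big_cons.
exact: LTD.
Qed.

Lemma LT1_integrable f : LT 1%E f ->
  mu.-integrable setT (EFin \o (fun t => Re (f (cis t)))) /\
  mu.-integrable setT (EFin \o (fun t => Im (f (cis t)))).
Proof. by move=> [/Lfun1_integrable ? /Lfun1_integrable ?]. Qed.

Lemma intTD f g : LT 1%E f -> LT 1%E g -> intT (fun z => f z + g z) =
  intT f + intT g.
Proof.
move=> /LT1_integrable[f1 f2] /LT1_integrable[g1 g2].
apply: complex_eqP; rewrite ?ReD ?ImD /intT /=.
  by rewrite -RintegralD//; apply: eq_Rintegral => t _; rewrite ReD.
by rewrite -RintegralD//; apply: eq_Rintegral => t _; rewrite ImD.
Qed.

Lemma intTZ c f : LT 1%E f -> intT (fun z => c * f z) = c * intT f.
Proof.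
move=> /LT1_integrable[f1 f2].
have Z (a : R) u : mu.-integrable setT (EFin \o u) ->
  mu.-integrable setT (EFin \o (fun t => a * u t)).
  by move=> /(integrableZl measurableT a); apply: eq_integrable.
apply: complex_eqP; rewrite ?ReM ?ImM /intT /= -!RintegralZl//.
  rewrite -RintegralB//; try exact: Z.
  by apply: eq_Rintegral => t _; rewrite ReM.
rewrite -RintegralD//; try exact: Z.
by apply: eq_Rintegral => t _; rewrite ImM.
Qed.

Lemma intTJ f : LT 1%E f -> intT (fun z => (f z)^*) = (intT f)^*.
Proof.
move=> /LT1_integrable[f1 f2]; apply: complex_eqP; rewrite ?ReJ ?ImJ /intT /=.
  by apply: eq_Rintegral => t _; rewrite ReJ.
rewrite -mulN1r -RintegralZl//.
by apply: eq_Rintegral => t _; rewrite ImJ mulN1r.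
Qed.

Lemma intT_ae f g : measT f -> measT g -> aeT (fun z => f z = g z) ->
  intT f = intT g.
Proof.
move=> [f1 f2] [g1 g2] fg; rewrite /intT /Rintegral; congr (fine _ +i* fine _)%C;
 apply: ae_eq_integral => //; try exact/measurable_EFinP;
 by apply: ae_arcS fg => t -> _.
Qed.

Lemma intT0 : intT (fun=> 0 : C) = 0.
Proof. by apply: complex_eqP; rewrite /intT /= /Rintegral integral0. Qed.

Lemma intT_sum (I : Type) (s : seq I) (F : I -> C -> C) :
  (forall i, LT 1%E (F i)) -> intT (fun z => \sum_(i <- s) F i z) =
    \sum_(i <- s) intT (F i).
Proof.
move=> LF; elim: s => [|i s IH].
  by rewrite big_nil -[RHS]intT0; apply: eq_intT => t; rewrite big_nil.
rewrite big_cons -IH -intTD//; last exact: LT_sum.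
by apply: eq_intT => t; rewrite big_cons.
Qed.

End ComplexFunctions.

(** * Orthogonality of the characters *)

Section Fourier.
Context {R : realType}.
Notation mu := (Defs.arc R).
Notation C := R[i].
Implicit Types (x y c : C) (f g h : C -> C).

Lemma integral_arc (u : R -> R) : measurable_fun setT u ->
  \int[mu]_t u t = \int[@lebesgue_measure R]_(t in `[0, 1]) u t.
Proof.
move=> mu'; rewrite /Rintegral; congr fine.
have mI : measurable (`[0, 1]%classic : set R) by exact: measurable_itv.
transitivity (\int[mu]_(t in `[0%R, 1%R]) (u t)%:E)%E; last first.
  by apply: eq_measure_integral => A _ AI; rewrite /Defs.arc /= /mrestr setIidl.
rewrite [RHS]integral_mkcond; apply: ae_eq_integral => //.
- exact/measurable_EFinP.
- apply/(measurable_restrictT _ _).1 => //.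
  by apply: measurable_funTS; exact/measurable_EFinP.
- apply: ae_arcS (ae_arc_itv (R := R)) => t t01 _; rewrite /patch.
  by rewrite mem_set //= in_itv.
Qed.

Lemma integral_arc_derive (u F : R -> R) : continuous u ->
  (forall x : R, is_derive x 1 F (u x)) -> \int[mu]_t u t = F 1 - F 0.
Proof.
move=> cu dF; rewrite integral_arc; last exact: continuous_measurable_fun.
have cF : continuous F.
  move=> x; apply: differentiable_continuous; apply/derivable1_diffP.
  by have [] := dF x.
rewrite /Rintegral (@continuous_FTC2 _ u F) //=.
- exact: continuous_subspaceT.
- split.
  + by move=> x _; have [] := dF x.
  + by apply: cvg_at_right_filter; exact: cF.
  + by apply: cvg_at_left_filter; exact: cF.
- by move=> x _; have [_ h] := dF x; rewrite derive1E h.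
Qed.

Lemma cisX (m : nat) t : (cis t : C) ^+ m = (cos (m%:R * (2 * pi * t))
  +i* sin (m%:R * (2 * pi * t)))%C.
Proof.
elim: m => [|m IH]; first by rewrite expr0 !mul0r cos0 sin0.
have E (w : R) : m.+1%:R * w = w + m%:R * w by rewrite -(natr1 m)
  mulrDl mul1r addrC.
rewrite exprS IH E cosD sinD.
by apply: complex_eqP; rewrite ?ReImE /=; ring.
Qed.

(** The cosine and the sine of 2 pi m t have antiderivatives of period 1 when
    m is a nonzero integer. *)
Lemma intT_exprz (k : int) : intT (fun z : C => z ^ k) = (k == 0)%:R.
Proof.
have pos m : intT (fun z : C => z ^+ m.+1) = 0.
  pose w : R := m.+1%:R * (2 * pi).
  have w0 : w != 0 by rewrite mulf_neq0// ?pnatr_eq0// gt_eqF// mulr_gt0// pi_gt0.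
  have dlin (x : R) : is_derive x 1 (fun t : R => w * t) w.
    by apply: is_derive_eq; rewrite /GRing.scale /= mulr1.
  have wper : w = 0 + (pi *+ 2) *+ m.+1.
    by rewrite /w add0r -[(pi *+ 2) *+ _]mulr_natl -[pi *+ 2]mulr_natl.
  have clin : continuous (fun t : R => w * t) by exact: mulrl_continuous.
  apply: complex_eqP; rewrite /intT /=.
  - transitivity (\int[mu]_t cos (w * t)).
      by apply: eq_Rintegral => t _; rewrite cisX /= mulrA.
    rewrite (_ : 0 = w^-1 * sin (w * 1) - w^-1 * sin (w * 0)); last first.
      by rewrite mulr1 mulr0 wper (periodicn (@sinD2pi R)) subrr.
    apply: (@integral_arc_derive (fun t => cos (w * t))
      (fun t => w^-1 * sin (w * t))).
    + by move=> t; apply: (@continuous_comp _ _ _ (fun t => w * t) cos) ;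
      [exact: clin|exact: continuous_cos].
    + move=> x; have dsin : is_derive x 1 (sin \o (fun t => w * t)) (cos (w * x)
      * w).
        exact: is_derive1_comp.
      have := is_deriveZ w^-1 dsin.
      by rewrite /GRing.scale /= mulrC mulfK.
  - transitivity (\int[mu]_t sin (w * t)).
      by apply: eq_Rintegral => t _; rewrite cisX /= mulrA.
    rewrite (_ : 0 = - w^-1 * cos (w * 1) - - w^-1 * cos (w * 0)); last first.
      by rewrite mulr1 mulr0 wper (periodicn (@cosD2pi R)) subrr.
    apply: (@integral_arc_derive (fun t => sin (w * t))
      (fun t => - w^-1 * cos (w * t))).
    + by move=> t; apply: (@continuous_comp _ _ _ (fun t => w * t) sin) ;
      [exact: clin|exact: continuous_sin].
    + move=> x; have dcos : is_derive x 1 (cos \o (fun t => w * t))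
      (- sin (w * x) * w).
        exact: is_derive1_comp.
      have := is_deriveZ (- w^-1) dcos.
      by rewrite /GRing.scale /= mulrC mulNr mulrNN mulfK.
case: k => [[|m]|m] /=.
- apply: complex_eqP; rewrite /intT /=.
    rewrite (_ : (fun t => _) = cst 1) //.
    by rewrite Rintegral_cst// arcT mul1r.
  by rewrite (_ : (fun t => _) = cst 0) // Rintegral_cst// mul0r.
- exact: pos.
- rewrite (_ : intT _ = (intT (fun z : C => z ^+ m.+1))^*);
  first by rewrite pos rmorph0.
  rewrite -intTJ; last by apply/LT2_LT1/LToo_LT2/(LToo_exprz m.+1).
  by apply: eq_intT => t; rewrite NegzE -(cisXJ t m.+1).
Qed.

End Fourier.

(** * The inner product of L^2 and Laurent polynomials *)

Section InnerProduct.
Context {R : realType}.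
Notation mu := (Defs.arc R).
Notation C := R[i].
Notation Re := complex.Re.
Notation Im := complex.Im.
Implicit Types (x y c : C) (f g h : C -> C).

Definition ip f g : C := intT (fun z => f z * (g z)^*).
Definition nsq f : R := Re (ip f f).

Lemma nsqE f : nsq f = \int[mu]_t sqabs (f (cis t)).
Proof. by apply: eq_Rintegral => t _; rewrite mulCJ. Qed.

Lemma ip_self f : ip f f = (nsq f)%:C%C.
Proof.
apply: complex_eqP => //=; rewrite (_ : (fun t => _) = cst 0); last first.
  by apply/funext => t; rewrite mulCJ.
by rewrite Rintegral_cst// mul0r.
Qed.

Lemma nsq_ge0 f : 0 <= nsq f.
Proof. by rewrite nsqE; apply: Rintegral_ge0 => t _; exact: sqabs_ge0. Qed.

Lemma LT1_ip f g : LT 2%:E f -> LT 2%:E g -> LT 1%E (fun z => f z * (g z)^*).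
Proof. by move=> Lf Lg; apply: LT2M => //; exact: LTJ. Qed.

Lemma ipJ f g : LT 2%:E f -> LT 2%:E g -> ip g f = (ip f g)^*.
Proof.
move=> Lf Lg; rewrite /ip -intTJ; last exact: LT1_ip.
by apply: eq_intT => t; apply: complex_eqP; rewrite !ReImE; ring.
Qed.

Lemma ipDl f1 f2 g : LT 2%:E f1 -> LT 2%:E f2 -> LT 2%:E g ->
  ip (fun z => f1 z + f2 z) g = ip f1 g + ip f2 g.
Proof.
move=> L1 L2 Lg; rewrite /ip -intTD; try exact: LT1_ip.
by apply: eq_intT => t; rewrite mulrDl.
Qed.

Lemma ipZl c f g : LT 2%:E f -> LT 2%:E g ->
  ip (fun z => c * f z) g = c * ip f g.
Proof.
move=> Lf Lg; rewrite /ip -intTZ; last exact: LT1_ip.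
by apply: eq_intT => t; rewrite mulrA.
Qed.

Lemma nsqB f g c : LT 2%:E f -> LT 2%:E g ->
  nsq (fun z => f z - c * g z) =
  nsq f - 2 * Re (c^* * ip f g) + sqabs c * nsq g.
Proof.
move=> Lf Lg; have Lcg : LT 2%:E (fun z => - c * g z) by exact: LTZ.
have Lh : LT 2%:E (fun z => f z + - c * g z) by exact: LTD.
rewrite {1}/nsq (_ : ip _ _ = ip (fun z => f z + - c * g z)
  (fun z => f z + - c * g z)); last first.
  by apply: eq_intT => t; rewrite mulNr.
rewrite ipDl// ipZl// [ip f _]ipJ// [ip g _]ipJ//.
rewrite !ipDl// !ipZl// !ip_self [ip g f]ipJ//.
by rewrite /sqabs /nsq !ReImE /=; ring.
Qed.

(** The square norm of f - s <f, g> g is nonnegative for all real s; s is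
    taken to be the inverse of the square norm of g, or large if that
    vanishes. *)
Lemma CauchySchwarz_ip f g : LT 2%:E f -> LT 2%:E g ->
  sqabs (ip f g) <= nsq f * nsq g.
Proof.
move=> Lf Lg; set a := ip f g.
have H (s : R) : 0 <= nsq f - 2 * s * sqabs a + s ^+ 2 * sqabs a * nsq g.
  have := nsq_ge0 (fun z => f z - (s%:C%C * a) * g z).
  rewrite nsqB// -/a (_ : 2 * Re _ = 2 * s * sqabs a); last first.
    by rewrite /sqabs !ReImE /=; ring.
  by rewrite sqabsM (_ : sqabs s%:C%C = s ^+ 2) // /sqabs /= expr0n addr0.
have a0 := sqabs_ge0 a; have f0 := nsq_ge0 f; have g0 := nsq_ge0 g.
have [gE|gn] := eqVneq (nsq g) 0.
  rewrite gE mulr0 leNgt; apply/negP => apos.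
  have := H ((nsq f + 1) / (2 * sqabs a)).
  rewrite gE mulr0 addr0.
  rewrite (_ : 2 * _ * _ = nsq f + 1); first by lra.
  by field; rewrite gt_eqF.
have gp : 0 < nsq g by rewrite lt_neqAle eq_sym gn.
have := H ((nsq g)^-1).
rewrite (_ : _ + _ = nsq f - sqabs a / nsq g); last by field.
by rewrite subr_ge0 ler_pdivrMr.
Qed.

Lemma nsq_eq0_ae f : LT 2%:E f -> nsq f = 0 -> aeT (fun z => f z = 0).
Proof.
move=> Lf nf; have /LT_2P[mf iF] := Lf.
have := iF => /integrable_fin_num => /(_ measurableT) /fineK.
rewrite (_ : fine _ = 0); last by rewrite -nf nsqE.
move=> /esym h.
have m2 : measurable_fun setT (fun t => (sqabs (f (cis t)))%:E).
  by apply/measurable_EFinP; exact: measT_sqabs.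
have /(ae_eq_integral_abs mu measurableT m2) :
  (\int[mu]_t `|(sqabs (f (cis t)))%:E| = 0)%E.
  by rewrite -[RHS]h; apply: eq_integral => t _;
    rewrite gee0_abs// lee_fin sqabs_ge0.
apply: ae_arcS => t /(_ Logic.I) /= [] /eqP.
by rewrite sqabs_eq0 => /eqP.
Qed.

Lemma nsq_small_ae f : LT 2%:E f -> (forall e, 0 < e -> nsq f <= e) ->
  aeT (fun z => f z = 0).
Proof.
move=> Lf H; apply: nsq_eq0_ae => //; apply/eqP; rewrite eq_le nsq_ge0 andbT.
by rewrite leNgt; apply/negP => h; have := H (nsq f / 2); lra.
Qed.

Definition laurent (P : {poly C}) (N : nat) (z : C) : C := P.[z] / z ^+ N.

Lemma trigp_laurent (p : R -> R) : trigp p ->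
  exists P N, forall t, (p t)%:C%C = laurent P N (cis t).
Proof.
have cV t : (cis t : C)^-1 = (cos (2 * pi * t) -i* sin (2 * pi * t))%C.
  by rewrite -cisJ.
elim=> [a| | |p1 p2 _ [P1 [N1 H1]] _ [P2 [N2 H2]]|p1 p2 _ [P1 [N1 H1]]
  _ [P2 [N2 H2]]].
- by exists (a%:C%C)%:P, 0%N => t; rewrite /laurent hornerC expr0 divr1.
- exists ((2^-1)%:C%C *: ('X^2 + 1)), 1%N => t.
  rewrite /laurent !hornerE (_ : _ / _ = (2^-1)%:C%C * (cis t + (cis t)^-1));
    last first.
    by field; exact: cis_neq0.
  by rewrite cV; apply: complex_eqP; rewrite /= ?ReImE /=; field.
- exists ((0 -i* 2^-1)%C *: ('X^2 - 1)), 1%N => t.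
  rewrite /laurent !hornerE (_ : _ / _ = (0 -i* 2^-1)%C * (cis t - (cis t)^-1));
    last first.
    by field; exact: cis_neq0.
  by rewrite cV; apply: complex_eqP; rewrite /= ?ReImE /=; field.
- exists (P1 * 'X^N2 + P2 * 'X^N1), (N1 + N2)%N => t.
  rewrite rmorphD /= H1 H2 /laurent !hornerE ?hornerXn exprD.
  by field; rewrite !expf_neq0 ?cis_neq0.
- exists (P1 * P2), (N1 + N2)%N => t.
  rewrite rmorphM /= H1 H2 /laurent hornerM exprD.
  by field; rewrite !expf_neq0 ?cis_neq0.
Qed.

Lemma LToo_horner (P : {poly C}) : LT +oo%E (fun z : C => P.[z]).
Proof.
apply: (@eq_LT _ _ (fun z => \sum_(i < size P) P`_i * z ^ i)) => [t|].
  by rewrite horner_coef.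
by apply: LT_sum => [|i]; [rewrite leey|apply: LTZ;
  [rewrite leey|exact: LToo_exprz]].
Qed.

Lemma LToo_LTooM f g : LT +oo%E f -> LT +oo%E g -> LT +oo%E (fun z => f z * g z).
Proof.
move=> /LT_ooP[mf [A fA]] /LT_ooP[mg [B gB]]; apply/LT_ooP; split;
  first exact: measTM.
exists (A * B); apply: aeTS (aeTI fA gB) => t [h1 h2]; rewrite sqabsM.
by apply: ler_pM => //; exact: sqabs_ge0.
Qed.

Lemma LToo_laurent P N : LT +oo%E (laurent P N).
Proof.
apply: (@eq_LT _ _ (fun z => P.[z] * z ^ (- N%:Z))) => [t|];
  first by rewrite /laurent exprnN.
by apply: LToo_LTooM; [exact: LToo_horner|exact: LToo_exprz].
Qed.

Lemma laurent_dense f e : LT 2%:E f -> 0 < e ->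
  exists P N, nsq (fun z => f z - laurent P N z) < e.
Proof.
move=> Lf e0; have e2 : 0 < e / 2 by rewrite divr_gt0.
have [f1 f2] := Lf; have [m1 m2] := LT_meas Lf.
have [p tp hp] := trig_approx_L2 m1 (Lfun2_integrable_sqr f1) e2.
have [q tq hq] := trig_approx_L2 m2 (Lfun2_integrable_sqr f2) e2.
have [P [N PN]] : exists P N, forall t, (p t +i* q t)%C = laurent P N (cis t).
  have [P1 [N1 H1]] := trigp_laurent tp; have [P2 [N2 H2]] := trigp_laurent tq.
  exists (P1 * 'X^N2 + 'i%C *: P2 * 'X^N1), (N1 + N2)%N => t.
  rewrite (complexE (_ +i* _)%C) /=
    H1 H2 /laurent hornerD !hornerM hornerZ !hornerXn exprD.
  by field; rewrite !expf_neq0 ?cis_neq0.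
exists P, N; rewrite nsqE -lte_fin.
have [mp _] := trigp_bounded_mfun tp; have [mq _] := trigp_bounded_mfun tq.
have [mu1 mv1] : measurable_fun setT (fun t => Re (f (cis t)) - p t) /\
   measurable_fun setT (fun t => Im (f (cis t)) - q t).
  by split; exact: measurable_funB.
have LL : LT 2%:E (fun z => f z - laurent P N z).
  apply: (@eq_LT _ _ (fun z => f z + (-1) * laurent P N z)) => [t|];
    first by rewrite mulN1r.
  by apply: LTD => //; apply: LTZ => //; apply: LToo_LT2; exact: LToo_laurent.
have /LT_2P[_ iL] := LL.
rewrite /Rintegral fineK; last exact: integrable_fin_num.
have -> : (\int[mu]_t (sqabs (f (cis t) - laurent P N (cis t)))%:E =
   sqnorm ((fun t => Re (f (cis t))) \- p)%R + sqnorm ((fun t => Im (f (cis t)))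
     \- q)%R)%E.
  rewrite /sqnorm -ge0_integralD //; try by move=> t _; rewrite lee_fin sqr_ge0.
  - by apply: eq_integral => t _; rewrite -PN -EFinD /sqabs !ReImE.
  - exact: measurable_sqr.
  - exact: measurable_sqr.
have -> : e%:E = ((e / 2)%:E + (e / 2)%:E)%E by rewrite -EFinD; congr EFin; field.
exact: lteD.
Qed.

End InnerProduct.

(** * Fourier coefficients and the scalar Hardy space *)

Section ScalarHardy.
Context {R : realType}.
Notation C := R[i].
Implicit Types (x y c : C) (f g h : C -> C) (k j : int).

Lemma LT2_exprz k : LT 2%:E (fun z : C => z ^ k).
Proof. by apply: LToo_LT2; exact: LToo_exprz. Qed.

Lemma LT2_exprn (n : nat) : LT 2%:E (fun z : C => z ^+ n).
Proof. exact: (LT2_exprz n). Qed.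

Lemma LT2_Mexprz f k : LT 2%:E f -> LT 2%:E (fun z => f z * z ^ k).
Proof.
move=> Lf; apply: (@eq_LT _ _ (fun z => z ^ k * f z)) => [t|];
  first by rewrite mulrC.
by apply: LTooM => //; exact: LToo_exprz.
Qed.

Lemma LT2B f g : LT 2%:E f -> LT 2%:E g -> LT 2%:E (fun z => f z - g z).
Proof.
move=> Lf Lg; apply: (@eq_LT _ _ (fun z => f z + (-1) * g z)) => [t|];
  first by rewrite mulN1r.
by apply: LTD => //; exact: LTZ.
Qed.

Lemma fourier_ip f k : fourier f k = ip f (fun z => z ^ k).
Proof. by apply: eq_intT => t; rewrite cisXJ. Qed.

Lemma eq_fourier f g k : (forall t, f (cis t) = g (cis t)) ->
  fourier f k = fourier g k.
Proof. by move=> fg; apply: eq_intT => t; rewrite fg. Qed.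

Lemma fourier_ae f g k : measT f -> measT g -> aeT (fun z => f z = g z) ->
  fourier f k = fourier g k.
Proof.
move=> mf mg fg; apply: intT_ae.
- by apply: measTM => //; exact: measT_exprz.
- by apply: measTM => //; exact: measT_exprz.
- by apply: aeTS fg => t ->.
Qed.

Lemma fourierD f g k : LT 2%:E f -> LT 2%:E g ->
  fourier (fun z => f z + g z) k = fourier f k + fourier g k.
Proof. by move=> Lf Lg; rewrite !fourier_ip ipDl//; exact: LT2_exprz. Qed.

Lemma fourierZ c f k : LT 2%:E f -> fourier (fun z => c * f z) k = c * fourier f k.
Proof. by move=> Lf; rewrite !fourier_ip ipZl//; exact: LT2_exprz. Qed.

Lemma fourierB f g k : LT 2%:E f -> LT 2%:E g ->
  fourier (fun z => f z - g z) k = fourier f k - fourier g k.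
Proof.
move=> Lf Lg; rewrite -mulN1r -fourierZ// -fourierD//; last exact: LTZ.
by apply: eq_fourier => t; rewrite mulN1r.
Qed.

Lemma fourier0 k : fourier (fun=> 0 : C) k = 0.
Proof. by rewrite -[RHS]intT0; apply: eq_intT => t; rewrite mul0r. Qed.

Lemma fourier_sum (I : Type) (s : seq I) (F : I -> C -> C) k :
  (forall i, LT 1%E (fun z => F i z * z ^ (- k))) ->
  fourier (fun z => \sum_(i <- s) F i z) k = \sum_(i <- s) fourier (F i) k.
Proof.
move=> LF; rewrite /fourier -intT_sum//.
by apply: eq_intT => t; rewrite mulr_suml.
Qed.

Lemma fourier_shift f k j : fourier (fun z => f z * z ^ j) k = fourier f (k - j).
Proof.
by apply: eq_intT => t; rewrite -mulrA -expfzDr ?cis_neq0// opprB.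
Qed.

Lemma fourier_exprz j k : fourier (fun z : C => z ^ j) k = (j == k)%:R.
Proof.
rewrite /fourier -(subr_eq0 j k) -intT_exprz; apply: eq_intT => t.
by rewrite -expfzDr ?cis_neq0.
Qed.

Lemma sqabs_fourier f k : LT 2%:E f -> sqabs (fourier f k) <= nsq f.
Proof.
move=> Lf; rewrite fourier_ip; apply:
  le_trans (CauchySchwarz_ip Lf (LT2_exprz k)) _.
rewrite [X in _ * X](_ : _ = 1) ?mulr1//.
rewrite nsqE (_ : (fun t => _) = cst 1).
  by rewrite Rintegral_cst// arcT mul1r.
by apply/funext => t; rewrite sqabs_cisX.
Qed.

Lemma Hardy_LT p f : Hardy p f -> LT p f. Proof. by case. Qed.
#[local] Hint Resolve Hardy_LT : core.

Lemma eq_Hardy p f g : (forall t, f (cis t) = g (cis t)) -> Hardy p f -> Hardy p g.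
Proof.
move=> fg [Lf ff]; split; first exact: eq_LT Lf.
by move=> k k0; rewrite -(eq_fourier k fg) ff.
Qed.

Lemma Hardy2_ae f g : measT g -> aeT (fun z => f z = g z) -> Hardy 2%:E f ->
  Hardy 2%:E g.
Proof.
move=> mg fg [Lf ff]; split; first exact: LT2_ae Lf.
by move=> k k0; rewrite -(ff k k0); apply/esym/fourier_ae => //; exact: LT_meas Lf.
Qed.

Lemma Hardyoo_2 f : Hardy +oo%E f -> Hardy 2%:E f.
Proof. by move=> [Lf ff]; split => //; exact: LToo_LT2. Qed.

Lemma Hardy2D f g : Hardy 2%:E f -> Hardy 2%:E g -> Hardy 2%:E (fun z => f z + g z).
Proof.
move=> [Lf ff] [Lg gg]; split; first exact: LTD.
by move=> k k0; rewrite fourierD// ff// gg// addr0.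
Qed.

Lemma Hardy2Z c f : Hardy 2%:E f -> Hardy 2%:E (fun z => c * f z).
Proof.
move=> [Lf ff]; split; first exact: LTZ.
by move=> k k0; rewrite fourierZ// ff// mulr0.
Qed.

Lemma Hardy2B f g : Hardy 2%:E f -> Hardy 2%:E g -> Hardy 2%:E (fun z => f z - g z).
Proof.
move=> [Lf ff] [Lg gg]; split; first exact: LT2B.
by move=> k k0; rewrite fourierB// ff// gg// subr0.
Qed.

Lemma Hardy2_cst0 : Hardy 2%:E (fun=> 0 : C).
Proof. by split; [exact: LT2_cst|move=> k _; exact: fourier0]. Qed.

Lemma Hardy2_sum (I : Type) (s : seq I) (F : I -> C -> C) :
  (forall i, Hardy 2%:E (F i)) -> Hardy 2%:E (fun z => \sum_(i <- s) F i z).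
Proof.
move=> HF; elim: s => [|i s IH].
  by apply: (@eq_Hardy _ (fun=> 0)) => [t|]; [rewrite big_nil|exact: Hardy2_cst0].
apply: (@eq_Hardy _ (fun z => F i z + \sum_(j <- s) F j z)) => [t|].
  by rewrite big_cons.
exact: Hardy2D.
Qed.

Lemma Hardy2_exprn (n : nat) : Hardy 2%:E (fun z : C => z ^+ n).
Proof.
split; first exact: LT2_exprn.
move=> k k0; rewrite (fourier_exprz n k).
by case: eqP => // nk; move: k0; rewrite -nk.
Qed.

Lemma Hardy2_cst c : Hardy 2%:E (fun=> c).
Proof.
apply: (@eq_Hardy _ (fun z => c * z ^+ 0)) => [t|]; first by rewrite expr0 mulr1.
by apply: Hardy2Z; exact: Hardy2_exprn.
Qed.

Lemma Hardy2_horner (P : {poly C}) : Hardy 2%:E (fun z : C => P.[z]).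
Proof.
apply: (@eq_Hardy _ (fun z => \sum_(i < size P) P`_i * z ^+ i)) => [t|].
  by rewrite horner_coef.
by apply: Hardy2_sum => i; apply: Hardy2Z; exact: Hardy2_exprn.
Qed.

Lemma LT2_horner (P : {poly C}) : LT 2%:E (fun z : C => P.[z]).
Proof. by have [] := Hardy2_horner P. Qed.

(** A Laurent polynomial is the sum of an analytic polynomial and of a
    combination of negative powers, which is orthogonal to H^2. By Pythagoras,
    dropping the latter only improves the approximation of a function of
    H^2. *)
Lemma Hardy2_approx f e : Hardy 2%:E f -> 0 < e ->
  exists P : {poly C}, nsq (fun z => f z - P.[z]) < e.
Proof.
move=> Hf e0; have [P [N b]] := laurent_dense (Hardy_LT Hf) e0.
pose P1 := drop_poly N P; pose n z : C := \sum_(i < N)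
  (take_poly N P)`_i * z ^ (i%:Z - N%:Z).
exists P1; apply: le_lt_trans; last exact: b.
pose h z := f z - P1.[z].
have Hh : Hardy 2%:E h by apply: Hardy2B => //; exact: Hardy2_horner.
have Lh := Hardy_LT Hh.
have Ln : LT 2%:E n by apply: LT_sum => // i; apply: LTZ => //; exact: LT2_exprz.
have hn : ip h n = 0.
  rewrite ipJ// /ip.
  rewrite (_ : intT _ = \sum_(i < N)
    (take_poly N P)`_i * (fourier h (i%:Z - N%:Z))^*).
    rewrite big1 ?rmorph0// => i _.
    by rewrite Hh.2 ?rmorph0 ?mulr0// subr_lt0 ltz_nat.
  transitivity (intT (fun z => \sum_(i < N)
    (take_poly N P)`_i * (z ^ (i%:Z - N%:Z) * (h z)^*))).
    by apply: eq_intT => t; rewrite mulr_suml; apply: eq_bigr => i _; rewrite mulrA.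
  rewrite intT_sum; last first.
    by move=> i; apply: LTZ => //; apply: LT1_ip => //; exact: LT2_exprz.
  apply: eq_bigr => i _; rewrite intTZ; last by apply: LT1_ip => //;
    exact: LT2_exprz.
  by rewrite fourier_ip -ipJ //; exact: LT2_exprz.
have E t : f (cis t) - laurent P N (cis t) = h (cis t) - 1 * n (cis t).
  rewrite /h mul1r -addrA -opprD; congr (_ - _).
  rewrite /laurent -{1}(poly_take_drop N P) hornerD hornerM hornerXn mulrDl addrC.
  rewrite mulfK ?expf_neq0 ?cis_neq0//; congr (_ + _).
  rewrite horner_coef (big_ord_widen N (fun i => (take_poly N P)`_i * cis t ^+
    i)) ?size_take_poly//.
  rewrite big_mkcond mulr_suml; apply: eq_bigr => i _.
  case: ltnP => [_|si]; last by rewrite mul0r nth_default ?mul0r.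
  by rewrite -mulrA expfzDr ?cis_neq0// -exprnN.
rewrite (_ : nsq (fun z => f z - laurent P N z) = nsq (fun z => h z - 1 * n z));
  last first.
  by rewrite !nsqE; apply: eq_Rintegral => t _; rewrite E.
rewrite nsqB// hn mulr0 /= mulr0 subr0 sqabs1 mul1r.
by rewrite lerDl nsq_ge0.
Qed.

(** Such a function belongs to H^2 and is orthogonal to the polynomials
    approximating it, so that the error of the approximation is at least its
    own norm. *)
Lemma fourier_eq0_ae f : LT 2%:E f -> (forall k, fourier f k = 0) ->
  aeT (fun z => f z = 0).
Proof.
move=> Lf ff; have Hf : Hardy 2%:E f by split.
apply: nsq_small_ae => // e e0; have [P /ltW] := Hardy2_approx Hf e0.
apply: le_trans; have LP := LT2_horner P.
have fP : ip f (fun z => P.[z]) = 0.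
  rewrite ipJ// /ip.
  transitivity (intT (fun z => \sum_(i < size P) P`_i * (z ^ i * (f z)^*)))^*.
    congr (_^*); apply: eq_intT => t; rewrite horner_coef mulr_suml.
    by apply: eq_bigr => i _; rewrite mulrA.
  have Lp (i : nat) : LT 1%E (fun z => z ^ i * (f z)^*).
    by apply: LT1_ip => //; exact: LT2_exprz.
  rewrite intT_sum; last by move=> i; apply: LTZ.
  rewrite big1 ?rmorph0// => i _; rewrite intTZ //.
  have := ipJ Lf (LT2_exprz i); rewrite /ip => ->.
  by rewrite -[intT _]/(ip _ _) -fourier_ip ff rmorph0 mulr0.
rewrite (_ : nsq (fun z => _ - _) = nsq (fun z => f z - 1 * P.[z])); last first.
  by rewrite !nsqE; apply: eq_Rintegral => t _; rewrite mul1r.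
rewrite nsqB// fP mulr0 /= mulr0 subr0 sqabs1 mul1r.
by rewrite lerDl nsq_ge0.
Qed.

Lemma le_small (a b : R) : (forall e, 0 < e -> a <= e * b) -> 0 <= b -> a <= 0.
Proof.
move=> H b0; rewrite leNgt; apply/negP => a0.
have := H (a / (2 * (b + 1))); rewrite divr_gt0 ?mulr_gt0 ?ltr_wpDl// => /(_ isT).
rewrite leNgt => /negP; apply.
have -> : a / (2 * (b + 1)) * b = a * (b / (2 * (b + 1))) by field;
  rewrite gt_eqF// ltr_wpDl.
by rewrite gtr_pMr// ltr_pdivrMr ?mulr_gt0 ?ltr_wpDl//; lra.
Qed.

(** If f is a polynomial, this is a combination of coefficients of negative
    index of g. The general case follows by approximation, because by
    Cauchy-Schwarz the coefficient depends continuously on f. *)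
Lemma fourier_Hardy2M f g k : Hardy 2%:E f -> Hardy 2%:E g -> k < 0 ->
  fourier (fun z => f z * g z) k = 0.
Proof.
move=> Hf Hg k0; have Lf := Hardy_LT Hf; have Lg := Hardy_LT Hg.
have Lg' : LT 2%:E (fun z => (g z * z ^ (- k))^*) by apply: LTJ => //;
  exact: LT2_Mexprz.
apply/eqP; rewrite -sqabs_eq0 eq_le sqabs_ge0 andbT.
apply: (@le_small _ (nsq (fun z => (g z * z ^ (- k))^*))); last exact: nsq_ge0.
move=> e e0; have [P fP] := Hardy2_approx Hf e0; have LP := LT2_horner P.
have LfP : LT 2%:E (fun z => f z - P.[z]) by exact: LT2B.
rewrite (_ : fourier _ k = ip (fun z => f z - P.[z])
  (fun z => (g z * z ^ (- k))^*)).
  apply: le_trans (CauchySchwarz_ip _ _) _ => //.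
  by rewrite ler_wpM2r ?nsq_ge0// ltW.
have zero : intT (fun z => P.[z] * (g z * z ^ (- k))) = 0.
  transitivity (intT (fun z => \sum_(i < size P) P`_i * ((g z * z ^ i)
    * z ^ (- k)))).
    apply: eq_intT => t; rewrite horner_coef mulr_suml; apply: eq_bigr => i _.
    by rewrite -[_ ^+ i]/(_ ^ i); ring.
  have Lp (i : nat) : LT 1%E (fun z => (g z * z ^ i) * z ^ (- k)).
    by apply/LT2_LT1; apply: LT2_Mexprz; exact: LT2_Mexprz.
  rewrite intT_sum; last by move=> i; apply: LTZ.
  rewrite big1 // => i _; rewrite intTZ //.
  rewrite -[intT _]/(fourier (fun z => g z * z ^ i) k) fourier_shift Hg.2 ?mulr0//.
  by rewrite ltrBlDr (lt_le_trans k0).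
have Lgk : LT 2%:E (fun z => g z * z ^ (- k)) by exact: LT2_Mexprz.
rewrite /fourier /ip; transitivity (intT (fun z => (f z - P.[z])
  * (g z * z ^ (- k)))); last first.
  by apply: eq_intT => t; congr (_ * _); apply: complex_eqP; rewrite !ReImE ?opprK.
transitivity (intT (fun z => f z * g z * z ^ (- k)) + (-1) * intT (fun z => P.[z]
  * (g z * z ^ (- k)))).
  by rewrite zero mulr0 addr0.
rewrite -intTZ; last exact: LT2M.
rewrite -intTD; [|by apply: (@eq_LT _ _ (fun z => f z * (g z * z ^ (- k)))) =>
  [t|]; [rewrite mulrA|exact: LT2M]|by apply: LTZ => //; exact: LT2M].
by apply: eq_intT => t; ring.
Qed.

Lemma Hardy2M f g : Hardy +oo%E f -> Hardy 2%:E g ->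
  Hardy 2%:E (fun z => f z * g z).
Proof.
move=> Hf Hg; split; first by apply: LTooM; exact: Hardy_LT.
by move=> k; apply: fourier_Hardy2M => //; exact: Hardyoo_2.
Qed.

Lemma Hardyoo_horner (P : {poly C}) : Hardy +oo%E (fun z : C => P.[z]).
Proof. by have [_ h] := Hardy2_horner P; split => //; exact: LToo_horner. Qed.

End ScalarHardy.

(** * Matrix and vector functions *)

Section MatrixHardy.
Context {R : realType}.
Notation C := R[i].
Notation Re := complex.Re.
Notation Im := complex.Im.

Definition measmx {m n} (F : C -> 'M[C]_(m, n)) :=
  forall i j, measT (fun z => F z i j).
Definition LTmx p {m n} (F : C -> 'M[C]_(m, n)) :=
  forall i j, LT p (fun z => F z i j).

Lemma adjointE m n (F : C -> 'M[C]_(m, n)) z i j : adjoint F z i j = (F z j i)^*.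
Proof. by rewrite /adjoint !mxE. Qed.

Lemma adjointM m n p (F : C -> 'M[C]_(m, n)) (G : C -> 'M[C]_(n, p)) z :
  adjoint (fun z => F z *m G z) z = adjoint G z *m adjoint F z.
Proof. by rewrite /adjoint trmx_mul map_mxM. Qed.

Lemma adjointK m n (F : C -> 'M[C]_(m, n)) z : adjoint (adjoint F) z = F z.
Proof. by apply/matrixP => i j; rewrite !adjointE conjCK. Qed.

Lemma LTmx_meas p m n (F : C -> 'M[C]_(m, n)) : LTmx p F -> measmx F.
Proof. by move=> LF i j; exact: LT_meas (LF i j). Qed.

Lemma Hardymx_LT p m n (F : C -> 'M[C]_(m, n)) : Hardymx p F -> LTmx p F.
Proof. by move=> HF i j; have [] := HF i j. Qed.

Lemma Hoo_H2 m n (F : C -> 'M[C]_(m, n)) : Hardymx +oo%E F -> Hardymx 2%:E F.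
Proof. by move=> HF i j; exact: Hardyoo_2. Qed.

Lemma LTmx_adj p m n (F : C -> 'M[C]_(m, n)) : (1 <= p)%E -> LTmx p F ->
  LTmx p (adjoint F).
Proof.
move=> p1 LF i j; apply: (@eq_LT _ _ (fun z => (F z j i)^*)) => [t|].
  by rewrite adjointE.
exact: LTJ.
Qed.

Lemma LTmx_mul m n p (F : C -> 'M[C]_(m, n)) (G : C -> 'M[C]_(n, p)) :
  LTmx +oo%E F -> LTmx 2%:E G -> LTmx 2%:E (fun z => F z *m G z).
Proof.
move=> LF LG i j; apply: (@eq_LT _ _ (fun z => \sum_k F z i k * G z k j)) => [t|].
  by rewrite mxE.
by apply: LT_sum => // k; exact: LTooM.
Qed.

Lemma LTmxoo_mul m n p (F : C -> 'M[C]_(m, n)) (G : C -> 'M[C]_(n, p)) :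
  LTmx +oo%E F -> LTmx +oo%E G -> LTmx +oo%E (fun z => F z *m G z).
Proof.
move=> LF LG i j; apply: (@eq_LT _ _ (fun z => \sum_k F z i k * G z k j)) => [t|].
  by rewrite mxE.
by apply: LT_sum => // k; exact: LToo_LTooM.
Qed.

Lemma measmx_mul m n p (F : C -> 'M[C]_(m, n)) (G : C -> 'M[C]_(n, p)) :
  measmx F -> measmx G -> measmx (fun z => F z *m G z).
Proof.
move=> LF LG i j; apply: (@eq_measT _ (fun z => \sum_k F z i k * G z k j)) => [t|].
  by rewrite mxE.
by apply: measT_sum => // k; exact: measTM.
Qed.

Lemma measmx_adj m n (F : C -> 'M[C]_(m, n)) : measmx F -> measmx (adjoint F).
Proof.
move=> LF i j; apply: (@eq_measT _ (fun z => (F z j i)^*)) => [t|].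
  by rewrite adjointE.
exact: measTJ.
Qed.

Lemma fourier_H2mul m n p (F : C -> 'M[C]_(m, n)) (G : C ->
  'M[C]_(n, p)) i j (k : int) :
  Hardymx 2%:E F -> Hardymx 2%:E G -> k < 0 ->
    fourier (fun z => (F z *m G z) i j) k = 0.
Proof.
move=> HF HG k0; transitivity (fourier (fun z => \sum_l F z i l * G z l j) k).
  by apply: eq_fourier => t; rewrite mxE.
rewrite fourier_sum => [|l].
  by rewrite big1// => l _; exact: fourier_Hardy2M.
apply: (@eq_LT _ _ (fun z => F z i l * (G z l j * z ^ (- k)))) => [t|];
  first by rewrite mulrA.
by apply: LT2M; [exact: Hardymx_LT|apply: LT2_Mexprz; exact: Hardymx_LT].
Qed.

Lemma Hardymx_mul m n p (F : C -> 'M[C]_(m, n)) (G : C -> 'M[C]_(n, p)) :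
  Hardymx +oo%E F -> Hardymx 2%:E G -> Hardymx 2%:E (fun z => F z *m G z).
Proof.
move=> HF HG i j; split; first by apply: LTmx_mul; exact: Hardymx_LT.
by move=> k; apply: fourier_H2mul => //; exact: Hoo_H2.
Qed.

(** A product of two H^2 functions is only integrable, but its coefficients of
    negative index vanish; to belong to H^2 it lacks nothing but square
    integrability. *)
Lemma Hardymx_mul_ae m n p (F : C -> 'M[C]_(m, n)) (G : C -> 'M[C]_(n, p)) H :
  Hardymx 2%:E F -> Hardymx 2%:E G -> LTmx 2%:E H ->
  aeT (fun z => H z = F z *m G z) -> Hardymx 2%:E H.
Proof.
move=> HF HG LH HE i j; split; first exact: LH.
move=> k k0; rewrite -(fourier_H2mul i j HF HG k0); apply: fourier_ae.
- exact: LT_meas (LH i j).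
- by apply: measmx_mul; apply: LTmx_meas; exact: Hardymx_LT.
- by apply: aeTS HE => t ->.
Qed.

Lemma Hardymx2_lin m n (I : finType) (c : I -> C) (F : I -> C -> 'M[C]_(m, n)) :
  (forall i, Hardymx 2%:E (F i)) -> Hardymx 2%:E (fun z => \sum_i c i *: F i z).
Proof.
move=> HF i j; apply: (@eq_Hardy _ _ (fun z => \sum_k c k * F k z i j)) => [t|].
  by rewrite summxE; apply: eq_bigr => k _; rewrite mxE.
by apply: Hardy2_sum => k; apply: Hardy2Z; exact: HF.
Qed.

Lemma dotTE n (f g : C -> 'cV[C]_n) z :
  (adjoint g z *m f z) 0 0 = \sum_i f z i 0 * (g z i 0)^*.
Proof. by rewrite mxE; apply: eq_bigr => i _; rewrite adjointE mulrC. Qed.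

Lemma dotT_ip n (f g : C -> 'cV[C]_n) : LTmx 2%:E f -> LTmx 2%:E g ->
  dotT f g = \sum_i ip (fun z => f z i 0) (fun z => g z i 0).
Proof.
move=> Lf Lg; rewrite /dotT /ip -intT_sum; last by move=> i; exact: LT1_ip.
by apply: eq_intT => t; rewrite dotTE.
Qed.

Lemma dotT_ae n (f g f' g' : C -> 'cV[C]_n) :
  measmx f -> measmx g -> measmx f' -> measmx g' ->
  aeT (fun z => adjoint g z *m f z = adjoint g' z *m f' z) -> dotT f g = dotT f' g'.
Proof.
move=> mf mg mf' mg' H; apply: intT_ae.
- exact: (measmx_mul (measmx_adj mg) mf).
- exact: (measmx_mul (measmx_adj mg') mf').
- by apply: aeTS H => t ->.
Qed.

Lemma dotT_mulmx n p (F : C -> 'M[C]_(n, p)) (f : C -> 'cV[C]_n) (g : C ->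
  'cV[C]_p) :
  dotT (fun z => adjoint F z *m f z) g = dotT f (fun z => F z *m g z).
Proof. by apply: eq_intT => t; rewrite adjointM mulmxA. Qed.

Lemma dotT_adjmulmx n p (F : C -> 'M[C]_(p, n)) (f : C -> 'cV[C]_n) (g : C ->
  'cV[C]_p) :
  dotT (fun z => F z *m f z) g = dotT f (fun z => adjoint F z *m g z).
Proof. by apply: eq_intT => t; rewrite adjointM mulmxA adjointK. Qed.

Lemma dotT_lin n (I : finType) (c : I -> C) (f : I -> C -> 'cV[C]_n) (g : C ->
  'cV[C]_n) :
  (forall i, LTmx 2%:E (f i)) -> LTmx 2%:E g ->
  dotT (fun z => \sum_i c i *: f i z) g = \sum_i c i * dotT (f i) g.
Proof.
move=> Lf Lg; have Lp i : LT 1%E (fun z => (adjoint g z *m f i z) 0 0).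
  apply: (@eq_LT _ _ (fun z => \sum_j f i z j 0 * (g z j 0)^*)) => [t|];
    first by rewrite dotTE.
  by apply: LT_sum => // j; exact: (LT1_ip (Lf i j 0) (Lg j 0)).
rewrite (eq_bigr (fun i => intT (fun z => c i * (adjoint g z *m f i z) 0 0)));
  last first.
  by move=> i _; rewrite intTZ.
rewrite -intT_sum; last by move=> i; exact: LTZ.
apply: eq_intT => t; rewrite mulmx_sumr summxE; apply: eq_bigr => i _.
by rewrite -scalemxAr mxE.
Qed.

Lemma model_space_lin n (Theta : C -> 'M[C]_n) (I : finType) (c : I ->
  C) (f : I -> C -> 'cV[C]_n) :
  inner Theta -> (forall i, model_space Theta (f i)) ->
  model_space Theta (fun z => \sum_i c i *: f i z).
Proof.
move=> [HT _] Kf; split; first by apply: Hardymx2_lin => i; have [] := Kf i.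
move=> g Hg; rewrite dotT_lin.
- by rewrite big1// => i _; have [_ ->] := Kf i; rewrite ?mulr0.
- by move=> i; have [+ _] := Kf i; exact: Hardymx_LT.
- by apply: LTmx_mul; exact: Hardymx_LT.
Qed.

(** The constant is crude; what matters is that it depends only on the number
    of terms. *)
Lemma sqabs_sum (I : Type) (s : seq I) (a : I -> C) :
  sqabs (\sum_(i <- s) a i) <= 2 ^+ size s * \sum_(i <- s) sqabs (a i).
Proof.
elim: s => [|i s IH]; first by rewrite !big_nil mulr0 /sqabs /= expr0n addr0.
rewrite !big_cons /= exprS; set S := \sum_(j <- s) a j in IH *.
set T := \sum_(j <- s) sqabs (a j) in IH *.
have h : sqabs (a i + S) <= 2 * sqabs (a i) + 2 * sqabs S.
  by rewrite /sqabs !ReImE; have := sqr_ge0 (Re (a i) - Re S); have :=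
    sqr_ge0 (Im (a i) - Im S); nra.
have p1 : 1 <= 2 ^+ size s :> R by rewrite exprn_ege1// ler1n.
by have := sqabs_ge0 (a i); nra.
Qed.

Lemma sqabs_dotT n (f g : C -> 'cV[C]_n) e : LTmx 2%:E f -> LTmx 2%:E g ->
  (forall i, nsq (fun z => g z i 0) <= e) ->
  sqabs (dotT f g) <= e * (2 ^+ n * \sum_i nsq (fun z => f z i 0)).
Proof.
move=> Lf Lg ge; rewrite dotT_ip// mulrCA.
apply: le_trans (sqabs_sum _ _) _.
have -> : size (index_enum 'I_n) = n.
  by rewrite [index_enum _]unlock -enumT size_enum_ord.
rewrite ler_pM2l ?exprn_gt0// mulr_sumr.
apply: ler_sum => i _; apply: le_trans (CauchySchwarz_ip _ _) _ => //.
by rewrite mulrC ler_wpM2r ?nsq_ge0.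
Qed.

Lemma sqnormT_nsq n (f : C -> 'cV[C]_n) (e : R) i : LTmx 2%:E f ->
  (sqnormT f < e%:E)%E -> nsq (fun z => f z i 0) <= e.
Proof.
move=> Lf h; have /LT_2P[_ iL] := Lf i 0.
rewrite nsqE -lee_fin /Rintegral fineK; last exact: integrable_fin_num.
apply/ltW/(le_lt_trans _ h); apply: ge0_le_integral => //.
- by move=> t _; rewrite lee_fin sqabs_ge0.
- by apply/measurable_EFinP; exact: (measT_sqabs (LT_meas (Lf i 0))).
- apply/measurable_EFinP; apply: measurable_sum => j.
  apply: (@eq_measurable_fun _ _ _ _ _ (fun t => sqabs (f (cis t) j 0))).
    by move=> t _; rewrite normc_sqr.
  by exact: (measT_sqabs (LT_meas (Lf j 0))).
- move=> t _; rewrite lee_fin (bigD1 i)//= normc_sqr lerDl sumr_ge0// => j _.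
  by rewrite sqr_ge0.
Qed.

Lemma aeT_col n (f : C -> 'cV[C]_n) : (forall i, aeT (fun z => f z i 0 = 0)) ->
  aeT (fun z => f z = 0).
Proof.
move=> H; apply: aeTS (aeT_forall H) => t h; apply/matrixP => i j.
by rewrite ord1 h mxE.
Qed.

End MatrixHardy.

(** * The degree inequality *)

Section DegreeInequality.
Context {R : realType} {n : nat}.
Notation C := R[i].
Implicit Types (F f g h : C -> 'cV[C]_n).
Implicit Types (Phi Theta Pi Pe A : C -> 'M[C]_n).

Lemma inner_LT m (Theta : C -> 'M[C]_(n, m)) : inner Theta -> LTmx +oo%E Theta.
Proof. by move=> [HT _]; exact: Hardymx_LT. Qed.

Lemma inner_mulV Theta : inner Theta ->
  aeT (fun z => Theta z *m adjoint Theta z = 1%:M).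
Proof. by move=> [_ H]; apply: aeTS H => t; exact: mulmx1C. Qed.

Lemma dotTBr f g h : LTmx 2%:E f -> LTmx 2%:E g -> LTmx 2%:E h ->
  dotT f (fun z => g z - h z) = dotT f g - dotT f h.
Proof.
move=> Lf Lg Lh; rewrite !dotT_ip//; last first.
  move=> i j; apply: (@eq_LT _ _ (fun z => g z i j - h z i j)) => [t|];
    first by rewrite !mxE.
  exact: LT2B.
rewrite -sumrB; apply: eq_bigr => i _; rewrite /ip -mulN1r -intTZ; last first.
  exact: (LT1_ip (Lf i 0) (Lh i 0)).
rewrite -intTD; last by apply: LTZ => //; exact: (LT1_ip (Lf i 0) (Lh i 0)).
  by apply: eq_intT => t; rewrite !mxE rmorphB; ring.
exact: (LT1_ip (Lf i 0) (Lg i 0)).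
Qed.

Lemma LTmx_scale_exprz f (k : int) : LTmx 2%:E f ->
  LTmx 2%:E (fun z => z ^ k *: f z).
Proof.
move=> Lf i j; apply: (@eq_LT _ _ (fun z => f z i j * z ^ k)) => [t|].
  by rewrite mxE mulrC.
exact: (LT2_Mexprz k (Lf i j)).
Qed.

Lemma dotT_monomial f (j : 'I_n) (l : int) : LTmx 2%:E f ->
  dotT f (fun z => z ^ l *: delta_mx j 0) = fourier (fun z => f z j 0) l.
Proof.
move=> Lf; apply: eq_intT => t; rewrite dotTE (bigD1 j)//= big1 => [|i ij].
  by rewrite addr0 !mxE !eqxx mulr1 cisXJ.
by rewrite !mxE (negbTE ij) mulr0 rmorph0 mulr0.
Qed.

Lemma Hardymx_monomial (j : 'I_n) (l : nat) :
  Hardymx 2%:E (fun z : C => z ^ l%:Z *: (delta_mx j 0 : 'cV[C]_n)).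
Proof.
move=> i k; apply: (@eq_Hardy _ _ (fun z => (delta_mx j 0 : 'cV[C]_n)
  i k * z ^+ l)) => [t|].
  by rewrite [RHS]mxE mulrC.
by apply: Hardy2Z; exact: Hardy2_exprn.
Qed.

(** The functions Pe p are dense in H^2 and the inner product is continuous. *)
Lemma outer_ortho Pe f : outer Pe -> LTmx 2%:E f ->
  (forall p : 'cV[{poly C}]_n, LTmx 2%:E (fun z => Pe z *m map_mx (horner^~ z) p) ->
     dotT f (fun z => Pe z *m map_mx (horner^~ z) p) = 0) ->
  forall h, Hardymx 2%:E h -> dotT f h = 0.
Proof.
move=> [HPe dPe] Lf fP h Hh; have Lh := Hardymx_LT Hh.
apply/eqP; rewrite -sqabs_eq0 eq_le sqabs_ge0 andbT.
apply: (@le_small _ _ (2 ^+ n * \sum_i nsq (fun z => f z i 0))); last first.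
  by rewrite mulr_ge0 ?exprn_ge0 ?sumr_ge0// => i _; exact: nsq_ge0.
move=> e e0; have se0 : 0 < Num.sqrt e by rewrite sqrtr_gt0.
have [p hp] := dPe h _ Hh se0.
rewrite sqr_sqrtr ?(ltW e0)// in hp.
have Lp : LTmx 2%:E (fun z => Pe z *m map_mx (horner^~ z) p).
  move=> i j; apply: (@eq_LT _ _ (fun z => \sum_k Pe z i k * (p k j).[z])) => [t|].
    by rewrite mxE; apply: eq_bigr => k _; rewrite mxE.
  apply: LT_sum => // k; apply: (@eq_LT _ _ (fun z => (p k j).[z]
    * Pe z i k)) => [t|].
    by rewrite mulrC.
  by apply: LTooM; [exact: LToo_horner|exact: (Hardymx_LT HPe)].
have Lph : LTmx 2%:E (fun z => Pe z *m map_mx (horner^~ z) p - h z).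
  move=> i j; apply: (@eq_LT _ _ (fun z => (Pe z *m map_mx (horner^~ z) p)
    i j - h z i j)) => [t|].
    by rewrite !mxE.
  exact: (LT2B (Lp i j) (Lh i j)).
have := dotTBr Lf Lp Lh; rewrite fP// sub0r => E.
rewrite (_ : sqabs (dotT f h) =
  sqabs (dotT f (fun z => Pe z *m map_mx (horner^~ z) p - h z))).
  by apply: sqabs_dotT => // i; exact: sqnormT_nsq.
by rewrite E /sqabs !ReImE !sqrrN.
Qed.

(** If Phi^* F = 0 then, for every integer m, z^m Pi^* F is orthogonal to the
    functions Pe p, hence to H^2. The monomials of H^2 divided by the z^m
    exhaust the characters, so that Pi^* F = 0, and F = Pi Pi^* F. *)
Lemma adjoint_inj Phi Pi Pe F : LTmx +oo%E Phi ->
  inner_outer_factorization Phi Pi Pe ->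
  LTmx 2%:E F -> aeT (fun z => adjoint Phi z *m F z = 0) -> aeT (fun z => F z = 0).
Proof.
move=> LPhi [iPi oPe PhiE] LF F0.
pose G z := adjoint Pi z *m F z.
have LG : LTmx 2%:E G by apply: LTmx_mul => //; apply: LTmx_adj => //;
  exact: inner_LT.
have ortho (m : int) h : Hardymx 2%:E h -> dotT (fun z => z ^ m *: G z) h = 0.
  apply: outer_ortho oPe _ _ h; first exact: LTmx_scale_exprz.
  move=> p Lp; rewrite (@dotT_ae _ _ _ _ (fun=> 0) (fun=> 0)).
  - rewrite -[RHS]intT0; apply: eq_intT => t; by rewrite mulmx0 mxE.
  - by apply: LTmx_meas; apply: LTmx_scale_exprz LG.
  - exact: LTmx_meas Lp.
  - by move=> i j; apply: (@eq_measT _ (fun=> 0)) => [t|];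
    [rewrite mxE|exact: measT_cst].
  - by move=> i j; apply: (@eq_measT _ (fun=> 0)) => [t|];
    [rewrite mxE|exact: measT_cst].
  apply: aeTS (aeTI PhiE F0) => t [E1 E2].
  rewrite mulmx0 -scalemxAr adjointM /G !mulmxA -[X in X *m F _]mulmxA.
  rewrite (_ : adjoint Pe (cis t) *m adjoint Pi (cis t) = adjoint Phi (cis t)).
    by rewrite -mulmxA E2 mulmx0 scaler0.
  by rewrite /adjoint E1 trmx_mul map_mxM.
have G0 : aeT (fun z => G z = 0).
  apply: aeT_col => j; apply: fourier_eq0_ae; first exact: LG.
  have key (l : nat) (m : int) : fourier (fun z => G z j 0) (l%:Z - m) = 0.
    rewrite -fourier_shift -(ortho m _ (Hardymx_monomial j l)) dotT_monomial;
      last exact: LTmx_scale_exprz.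
    by apply: eq_fourier => t; rewrite [RHS]mxE mulrC.
  move=> k; have := key 0%N (- k); by rewrite sub0r opprK.
apply: aeTS (aeTI G0 (inner_mulV iPi)) => t [E1 E2].
by rewrite -[F _]mul1mx -E2 -mulmxA -/(G _) E1 mulmx0.
Qed.

(** Phi h = Pi k with k = Pi^* Phi h. As k agrees with Pe h and is square
    integrable, it belongs to H^2. *)
Lemma model_space_ortho Phi Pi Pe f h : Hardymx +oo%E Phi ->
  inner_outer_factorization Phi Pi Pe -> model_space Pi f -> Hardymx 2%:E h ->
  dotT f (fun z => Phi z *m h z) = 0.
Proof.
move=> HPhi [iPi [HPe _] PhiE] [Hf Kf] Hh.
pose k z := adjoint Pi z *m (Phi z *m h z).
have LPhi : LTmx +oo%E Phi := Hardymx_LT HPhi.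
have LPi := inner_LT iPi.
have LPh : LTmx 2%:E (fun z => Phi z *m h z) by apply: LTmx_mul => //;
  exact: Hardymx_LT.
have Lk : LTmx 2%:E k by apply: LTmx_mul => //; exact: LTmx_adj.
have kE : aeT (fun z => k z = Pe z *m h z).
  by apply: aeTS (aeTI PhiE iPi.2) => t [E1 E2]; rewrite /k E1 !mulmxA E2 mul1mx.
have Hk : Hardymx 2%:E k := Hardymx_mul_ae HPe Hh Lk kE.
rewrite -(Kf _ Hk); apply: dotT_ae; try exact: LTmx_meas (Hardymx_LT Hf).
- exact: LTmx_meas LPh.
- by apply: (LTmx_meas (p := 2%:E)); apply: LTmx_mul.
apply: aeTS (inner_mulV iPi) => t E.
by rewrite /k !adjointM adjointK -!mulmxA [Pi _ *m _]mulmxA E mul1mx.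
Qed.

(** This function agrees with A f, hence lies in H^2; it is orthogonal to
    Theta H^2 because Phi^* f is orthogonal to H^2. *)
Lemma model_space_transfer Phi Pi Pe A Theta f : Hardymx +oo%E Phi ->
  inner_outer_factorization Phi Pi Pe ->
  inner Theta -> Hardymx 2%:E A -> aeT (fun z => Phi z = adjoint A z *m Theta z) ->
  model_space Pi f -> model_space Theta (fun z => Theta z *m (adjoint Phi z *m f
    z)).
Proof.
move=> HPhi ioP iT HA PhiE Kf; have [Hf _] := Kf.
have LPhi : LTmx +oo%E Phi := Hardymx_LT HPhi.
have LT := inner_LT iT; have Lf := Hardymx_LT Hf.
have Lg : LTmx 2%:E (fun z => adjoint Phi z *m f z) by apply: LTmx_mul => //;
  exact: LTmx_adj.
have LTg : LTmx 2%:E (fun z => Theta z *m (adjoint Phi z *m f z))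
  by exact: LTmx_mul.
split.
  apply: (Hardymx_mul_ae HA Hf LTg).
  apply: aeTS (aeTI PhiE (inner_mulV iT)) => t [E1 E2].
  by rewrite /adjoint E1 trmx_mul map_mxM mulmxA -/(adjoint Theta _)
    mulmxA E2 mul1mx -/(adjoint _ _) adjointK.
move=> h Hh; rewrite -(model_space_ortho HPhi ioP Kf Hh) -[RHS]dotT_mulmx.
have Lh := Hardymx_LT Hh.
apply: dotT_ae; try exact: LTmx_meas LTg; try exact: LTmx_meas Lg;
  try exact: LTmx_meas Lh.
- by apply: (LTmx_meas (p := 2%:E)); exact: LTmx_mul.
by apply: aeTS iT.2 => t E; rewrite adjointM -mulmxA [X in _ *m X]mulmxA E mul1mx.
Qed.

Lemma deg_inner_factor_le Phi Pi Pe A Theta : Hardymx +oo%E Phi ->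
  inner_outer_factorization Phi Pi Pe ->
  inner Theta -> Hardymx 2%:E A -> aeT (fun z => Phi z = adjoint A z *m Theta z) ->
  (deg Pi <= deg Theta)%E.
Proof.
move=> HPhi ioP iT HA PhiE; apply: ge_ereal_sup => _ [k [f [Kf If]] <-].
apply: ereal_sup_ubound; exists k => //.
exists (fun i z => Theta z *m (adjoint Phi z *m f i z)); split.
  by move=> i; exact: (model_space_transfer HPhi ioP iT HA PhiE (Kf i)).
move=> c c0; apply: If; apply: (adjoint_inj (Hardymx_LT HPhi) ioP).
  by apply: Hardymx_LT; apply: Hardymx2_lin => i; have [] := Kf i.
apply: aeTS (aeTI c0 iT.2) => t [E1 E2].
have E3 : Theta (cis t) *m (adjoint Phi (cis t) *m \sum_i c i *: f i (cis t)) = 0.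
  rewrite -[RHS]E1 !mulmx_sumr; apply: eq_bigr => i _.
  by rewrite -!scalemxAr.
by rewrite -[LHS]mul1mx -E2 -mulmxA E3 mulmx0.
Qed.

End DegreeInequality.

(** * The backward shift on a model space *)

Section BackwardShift.
Context {R : realType} {n : nat}.
Notation C := R[i].
Implicit Types (f g h : C -> 'cV[C]_n).
Implicit Types (Theta : C -> 'M[C]_n).

Definition fhat0 f : 'cV[C]_n := \col_i fourier (fun z => f z i 0) 0.
(** The backward shift: it lowers the index of the Fourier coefficients by one
    and forgets the coefficient of index 0. *)
Definition bshift f (z : C) : 'cV[C]_n := z ^ (-1) *: (f z - fhat0 f).

Lemma fourier_cst (c : C) (k : int) : fourier (fun=> c) k = c * (k == 0)%:R.
Proof.
rewrite eq_sym -fourier_exprz -fourierZ; last exact: LT2_exprz.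
by apply: eq_fourier => t; rewrite expr0z mulr1.
Qed.

Lemma fourier_bshift f i (k : int) : Hardymx 2%:E f ->
  fourier (fun z => bshift f z i 0) k =
  fourier (fun z => f z i 0) (k + 1) - fhat0 f i 0 * (k + 1 == 0)%:R.
Proof.
move=> Hf; rewrite -fourier_cst -fourierB; [|exact: Hardy_LT|exact: LT2_cst].
rewrite -[1]opprK -fourier_shift; apply: eq_fourier => t.
by rewrite !mxE mulrC.
Qed.

Lemma Hardymx_bshift f : Hardymx 2%:E f -> Hardymx 2%:E (bshift f).
Proof.
move=> Hf i j; rewrite ord1; split.
  apply: (@eq_LT _ _ (fun z => (f z i 0 - fhat0 f i 0) * z ^ (-1))) => [t|].
    by rewrite !mxE mulrC.
  by apply: LT2_Mexprz; apply: LT2B; [exact: Hardymx_LT|exact: LT2_cst].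
move=> k k0; rewrite fourier_bshift//.
have [->|k1] := eqVneq (k + 1) 0; first by rewrite mulr1 mxE subrr.
rewrite mulr0 subr0; have [_ ->] := Hf i 0 => //.
by rewrite lt_neqAle k1 addrC lez1D.
Qed.

Lemma LTmx2_cst (c : 'cV[C]_n) : LTmx 2%:E (fun=> c).
Proof. by move=> i j; exact: LT2_cst. Qed.

Lemma dotTJ f g : LTmx 2%:E f -> LTmx 2%:E g -> dotT g f = (dotT f g)^*.
Proof.
move=> Lf Lg; rewrite !dotT_ip// rmorph_sum; apply: eq_bigr => i _.
by rewrite (ipJ (Lf i 0) (Lg i 0)).
Qed.

Lemma LTmx2B f g : LTmx 2%:E f -> LTmx 2%:E g -> LTmx 2%:E (fun z => f z - g z).
Proof.
move=> Lf Lg i j; apply: (@eq_LT _ _ (fun z => f z i j - g z i j)) => [t|];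
  first by rewrite !mxE.
exact: LT2B.
Qed.

Lemma dotTBl f g h : LTmx 2%:E f -> LTmx 2%:E g -> LTmx 2%:E h ->
  dotT (fun z => f z - g z) h = dotT f h - dotT g h.
Proof.
move=> Lf Lg Lh; rewrite (dotTJ Lh (LTmx2B Lf Lg)) dotTBr// rmorphB.
by rewrite (dotTJ Lh Lf) (dotTJ Lh Lg).
Qed.

Lemma dotT_cst (c : 'cV[C]_n) h : LTmx 2%:E h ->
  dotT (fun=> c) h = \sum_i c i 0 * (fourier (fun z => h z i 0) 0)^*.
Proof.
move=> Lh; rewrite dotT_ip//; last exact: LTmx2_cst.
apply: eq_bigr => i _; rewrite /ip intTZ; last by apply: LT2_LT1;
  apply: LTJ => //; exact: Lh.
congr (_ * _); rewrite intTJ; last by apply: LT2_LT1; exact: Lh.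
by congr (_^*); apply: eq_intT => t; rewrite oppr0 expr0z mulr1.
Qed.

(** The inner product of the backward shift of f and Theta g is that of f -
    f^(0) and z Theta g, and constants are orthogonal to z H^2. *)
Lemma bshift_model Theta f : inner Theta -> Hardymx 2%:E f ->
  (forall g, Hardymx 2%:E g -> dotT f (fun z => Theta z *m (z ^ 1 *: g z)) = 0) ->
  model_space Theta (bshift f).
Proof.
move=> [HT _] Hf Hort; split; first exact: Hardymx_bshift.
move=> g Hg; have HTg := Hardymx_mul HT Hg; have LTg := Hardymx_LT HTg.
have Lz := LTmx_scale_exprz 1 LTg.
transitivity (dotT (fun z => f z - fhat0 f) (fun z => z ^ 1 *: (Theta z *m g z))).
  apply: eq_intT => t; rewrite dotTE [RHS](dotTE (fun z => f z - fhat0 f)).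
  apply: eq_bigr => i _.
  have Z (a : C) (X : 'cV[C]_n) : (a *: X) i 0 = a * X i 0 by rewrite mxE.
  by rewrite /bshift !Z rmorphM /= cisXJ; ring.
rewrite dotTBl//; [|exact: Hardymx_LT|exact: LTmx2_cst].
rewrite [X in X - _](_ : _ = 0); last first.
  rewrite -(Hort g Hg); by apply: eq_intT => t; congr ((_ *m _) _ _);
    rewrite /adjoint -scalemxAr.
rewrite sub0r dotT_cst// big1 ?oppr0// => i _.
rewrite (_ : fourier _ 0 = 0) ?rmorph0 ?mulr0//.
transitivity (fourier (fun z => (Theta z *m g z) i 0) (-1));
  last by have [_ ->] := HTg i 0.
rewrite -[-1]sub0r -fourier_shift; apply: eq_fourier => t.
by rewrite [LHS]mxE mulrC.
Qed.

Lemma Hardymx_shift f : Hardymx 2%:E f -> Hardymx 2%:E (fun z => z ^ 1 *: f z).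
Proof.
move=> Hf i j; apply: (@eq_Hardy _ _ (fun z => ('X : {poly C}).[z]
  * f z i j)) => [t|].
  by rewrite [RHS]mxE hornerX expr1z.
by apply: Hardy2M => //; exact: Hardyoo_horner.
Qed.

Lemma model_space_bshift Theta f : inner Theta -> model_space Theta f ->
  model_space Theta (bshift f).
Proof.
move=> iT [Hf Kf]; apply: (bshift_model iT Hf) => g Hg.
exact: (Kf _ (Hardymx_shift Hg)).
Qed.

Lemma dotT_inner Theta f g : inner Theta -> measmx f -> measmx g ->
  dotT (fun z => Theta z *m f z) (fun z => Theta z *m g z) = dotT f g.
Proof.
move=> iT mf mg; have mT := LTmx_meas (inner_LT iT).
apply: dotT_ae => //; try exact: measmx_mul.
apply: aeTS iT.2 => t E; rewrite adjointM -mulmxA [X in _ *m X]mulmxA E mul1mx.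
by [].
Qed.

(** Multiplication by Theta preserves inner products, so that this is again
    the orthogonality of constants to z H^2. *)
Lemma bshift_inner_model Theta (j : 'I_n) : inner Theta ->
  model_space Theta (bshift (fun z => Theta z *m delta_mx j 0)).
Proof.
move=> iT; have Hd : Hardymx 2%:E (fun=> delta_mx j 0 : 'cV[C]_n).
  by move=> i k; exact: Hardy2_cst.
apply: bshift_model => //; first by apply: Hardymx_mul => //; case: iT.
move=> g Hg; have Hzg : Hardymx 2%:E (fun z => z ^ 1 *: g z)
  by exact: Hardymx_shift.
have Lzg := Hardymx_LT Hzg.
rewrite (dotT_inner iT (LTmx_meas (Hardymx_LT Hd)) (LTmx_meas Lzg)).
rewrite dotT_cst// big1// => i _.
rewrite (_ : fourier _ 0 = 0) ?rmorph0 ?mulr0//.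
transitivity (fourier (fun z => g z i 0) (-1)); last by have [_ ->] := Hg i 0.
rewrite -[-1]sub0r -fourier_shift; apply: eq_fourier => t.
by rewrite [LHS]mxE mulrC.
Qed.

(** The model space contains the backward shifts of the columns of Theta,
    which are constant as soon as these vanish. *)
Lemma inner_trivial_model Theta : inner Theta ->
  (forall f, model_space Theta f -> aeT (fun z => f z = 0)) ->
  exists2 U : 'M[C]_n, U \is unitarymx & aeT (fun z => Theta z = U).
Proof.
move=> iT K0.
pose U : 'M[C]_n := \matrix_(i, j) fhat0 (fun z => Theta z *m delta_mx j 0) i 0.
have TU : aeT (fun z => Theta z = U).
  have H j : aeT (fun z => Theta z *m delta_mx j 0 =
    fhat0 (fun z => Theta z *m delta_mx j 0)).
    apply: aeTS (K0 _ (bshift_inner_model j iT)) => t /eqP.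
    rewrite /bshift scaler_eq0 expfz_eq0 (negbTE (cis_neq0 t)) andbF /= subr_eq0.
    by move/eqP.
  apply: aeTS (aeT_forall H) => t E; apply/matrixP => i j.
  by rewrite [RHS]mxE -E -colE mxE.
exists U => //.
have [t [E1 E2]] := aeT_ex (aeTI TU (inner_mulV iT)).
by apply/unitarymxP; rewrite -E1.
Qed.

Definition fcons k (g : C -> 'cV[C]_n) (f : 'I_k -> C -> 'cV[C]_n) (i : 'I_k.+1) :=
  oapp f g (unlift ord0 i).

Lemma fcons0 k g (f : 'I_k -> C -> 'cV[C]_n) : fcons g f ord0 = g.
Proof. by rewrite /fcons unlift_none. Qed.

Lemma fconsS k g (f : 'I_k -> C -> 'cV[C]_n) i : fcons g f (lift ord0 i) = f i.
Proof. by rewrite /fcons liftK. Qed.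

Lemma model_space_fcons Theta k g (f : 'I_k -> C -> 'cV[C]_n) :
  model_space Theta g -> (forall i, model_space Theta (f i)) ->
  forall i, model_space Theta (fcons g f i).
Proof. by move=> Kg Kf i; rewrite /fcons; case: unliftP => //=. Qed.

(** The bound on the degree by a natural number, in the form in which an
    induction can use it. *)
Definition deg_le (d : nat) Theta := forall k (f : 'I_k -> C -> 'cV[C]_n),
  (forall i, model_space Theta (f i)) -> lin_indepT f -> (k <= d)%N.

Lemma aeT_scale_eq0 (c : C) f : ~ aeT (fun z => f z = 0) ->
  aeT (fun z => c *: f z = 0) -> c = 0.
Proof.
move=> nf cf; apply/eqP; apply: contraPT nf => c0; rewrite notK.
apply: aeTS cf => t /eqP; rewrite scaler_eq0 (negbTE c0) /=.
by move/eqP.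
Qed.

(** A linearly independent family of maximal size: adding any function of the
    model space makes it dependent. *)
Lemma model_space_basis Theta d : inner Theta -> deg_le d Theta ->
  exists k (f : 'I_k -> C -> 'cV[C]_n),
    [/\ forall i, model_space Theta (f i), lin_indepT f &
      forall g, model_space Theta g ->
        exists a : 'I_k -> C, aeT (fun z => g z = \sum_i a i *: f i z)].
Proof.
move=> iT dT.
pose P k := `[< exists f : 'I_k -> C -> 'cV[C]_n,
   (forall i, model_space Theta (f i)) /\ lin_indepT f >].
have exP : exists k, P k.
  exists 0%N; apply/asboolP; exists (fun _ _ => 0); split; first by case.
  by move=> c _ [].
have ubP k : P k -> (k <= d)%N by move=> /asboolP[f [Kf If]]; exact: dT If.
have [k /asboolP[f [Kf If]] kmax] := ex_maxnP exP ubP.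
exists k, f; split => // g Kg.
have nI : ~ lin_indepT (fcons g f).
  move=> I1; suff : P k.+1 by move/kmax; rewrite ltnn.
  by apply/asboolP; exists (fcons g f); split => //; exact: model_space_fcons.
move: nI => /existsNP[c /not_implyP[c0 /existsNP[i ci]]].
have E : aeT (fun z => c ord0 *: g z + \sum_(i < k) c (lift ord0 i) *: f i z = 0).
  apply: aeTS c0 => t; rewrite big_ord_recl fcons0.
  by under eq_bigr do rewrite fconsS.
have cn0 : c ord0 != 0.
  apply/eqP => h; apply: ci; have H : forall j, c (lift ord0 j) = 0.
    by apply: If; apply: aeTS E => t; rewrite h scale0r add0r.
  by case: (unliftP ord0 i) => [j ->|->].
exists (fun j => - c (lift ord0 j) / c ord0).
apply: aeTS E => t /eqP; rewrite addr_eq0 => /eqP E.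
rewrite -[LHS]scale1r -(mulVf cn0) -scalerA E scalerN scaler_sumr -sumrN.
by apply: eq_bigr => j _; rewrite scalerA -scaleNr mulrC mulNr.
Qed.

Lemma fhat0_lin k (c : 'I_k -> C) (f : 'I_k -> C -> 'cV[C]_n) :
  (forall i, LTmx 2%:E (f i)) ->
  fhat0 (fun z => \sum_i c i *: f i z) = \sum_i c i *: fhat0 (f i).
Proof.
move=> Lf; apply/matrixP => i j; rewrite ord1 !mxE summxE.
transitivity (fourier (fun z => \sum_l c l * f l z i 0) 0).
  by apply: eq_fourier => t; rewrite summxE; apply: eq_bigr => l _; rewrite mxE.
rewrite fourier_sum => [|l].
  by apply: eq_bigr => l _; rewrite !mxE fourierZ//; exact: Lf.
apply: (@eq_LT _ _ (fun z => c l * (f l z i 0 * z ^ (- 0)))) => [t|];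
  first by rewrite mulrA.
by apply: LTZ => //; apply/LT2_LT1/LT2_Mexprz; exact: Lf.
Qed.

Lemma bshift_lin k (c : 'I_k -> C) (f : 'I_k -> C -> 'cV[C]_n) z :
  (forall i, LTmx 2%:E (f i)) ->
  bshift (fun z => \sum_i c i *: f i z) z = \sum_i c i *: bshift (f i) z.
Proof.
move=> Lf; rewrite /bshift fhat0_lin// -sumrB scaler_sumr; apply: eq_bigr => i _.
by rewrite -scalerBr !scalerA mulrC.
Qed.

(** The backward shift acts on a spanning independent family through a matrix,
    which has an eigenvector over the complex numbers. *)
Lemma bshift_eigenvector Theta d f : inner Theta -> deg_le d Theta ->
  model_space Theta f -> ~ aeT (fun z => f z = 0) ->
  exists h mu, [/\ model_space Theta h, ~ aeT (fun z => h z = 0) &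
    aeT (fun z => bshift h z = mu *: h z)].
Proof.
move=> iT dT Kf nf; have [k [e [Ke Ie span]]] := model_space_basis iT dT.
have Le i : LTmx 2%:E (e i) by have [He _] := Ke i; exact: Hardymx_LT.
have k0 : (0 < k)%N.
  rewrite lt0n; apply/eqP => k0; apply: nf; have [a] := span _ Kf.
  by apply: aeTS => t ->; subst k; rewrite big_ord0.
have /fin_all_exists[A HA] : forall i, exists a : 'I_k -> C,
    aeT (fun z => bshift (e i) z = \sum_j a j *: e j z).
  by move=> i; apply: span; exact: model_space_bshift.
pose M : 'M[C]_k := \matrix_(i, j) A i j.
have [mu /eigenvalueP[v vM v0]] := eigenvalue_closed M k0.
exists (fun z => \sum_i v 0 i *: e i z), mu; split.
- exact: model_space_lin.
- move=> h; move/eqP: v0; apply; apply/matrixP => i j.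
  by rewrite ord1 (Ie _ h) mxE.
apply: aeTS (aeT_forall HA) => t E.
rewrite bshift_lin//; under eq_bigr do rewrite E scaler_sumr.
rewrite exchange_big scaler_sumr /=; apply: eq_bigr => j _.
have /matrixP/(_ 0 j) := vM; rewrite !mxE scalerA => <-.
rewrite scaler_suml; apply: eq_bigr => i _.
by rewrite scalerA mxE.
Qed.

End BackwardShift.

(** * Zeros of polynomials and kernels in a model space *)

Section AlmostEverywherePolynomials.
Context {R : realType}.
Notation C := R[i].
Notation Re := complex.Re.

Lemma ae_arc_neq_ex (P : R -> Prop) : (forall s t, P s -> P t -> s = t) ->
  {ae Defs.arc R, forall t, ~ P t}.
Proof.
move=> Pu; have [[c Pc]|nP] := pselect (exists c, P c).
  by apply: ae_arcS (ae_arc_neq c) => t /eqP tc Pt; apply: tc; exact: Pu.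
by apply: aeW => t Pt; apply: nP; exists t.
Qed.

(** Each half of the circle meets the vertical line through a at most once. *)
Lemma aeT_neq (a : C) : aeT (fun z => z != a).
Proof.
have pp := pi_gt0 R.
have inj (s t : R) : 0 <= s <= 1 / 2 -> 0 <= t <= 1 / 2 ->
    cos (2 * pi * s) = cos (2 * pi * t) -> s = t.
  move=> s01 t01 /cos_inj; rewrite !in_itv /= => H.
  have : 2 * pi * s = 2 * pi * t by apply: H; apply/andP; split; nra.
  by apply: mulfI; rewrite mulf_neq0// gt_eqF.
have H1 := @ae_arc_neq_ex (fun t => 0 <= t <= 1 / 2 /\ cos (2 * pi * t) = Re a).
have H2 := @ae_arc_neq_ex (fun t => 0 <= 1 - t <= 1 / 2 /\
  cos (2 * pi * (1 - t)) = Re a).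
apply: ae_arcS (ae_arcI (ae_arc_itv (R := R)) (ae_arcI (H1 _) (H2 _))).
- move=> t [t01 [n1 n2]]; apply/negP => /eqP ta.
  have ct : cos (2 * pi * t) = Re a by rewrite -ta.
  have [th|th] := leP t (1 / 2).
    by apply: n1; split => //; have /andP[-> _] := t01.
  apply: n2; split; first lra.
  rewrite -ct (_ : 2 * pi * (1 - t) = - (2 * pi * t) + pi *+ 2).
    by rewrite cosD2pi cosN.
  by rewrite -[pi *+ 2]mulr_natl; ring.
- by move=> s t [s1 s2] [t1 t2]; apply: inj => //; rewrite s2.
- move=> s t [s1 s2] [t1 t2]; have : 1 - s = 1 - t by apply: inj => //; rewrite s2.
  lra.
Qed.

Lemma aeT_horner_neq0 (q : {poly C}) : q != 0 -> aeT (fun z => q.[z] != 0).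
Proof.
move=> q0; have [rs qE] := closed_field_poly_normal q.
have H : aeT (fun z => z \notin rs).
  elim: rs {qE} => [|r rs IH]; first exact: aeTW.
  by apply: aeTS (aeTI (aeT_neq r) IH) => t [h1 h2]; rewrite inE negb_or h1.
apply: aeTS H => t trs; rewrite qE hornerZ mulf_neq0 ?lead_coef_eq0//.
rewrite horner_prod prodf_seq_neq0; apply/allP => r rrs /=.
rewrite hornerXsubC subr_eq0; apply: contra trs => /eqP ->.
exact: rrs.
Qed.

End AlmostEverywherePolynomials.

Section Kernels.
Context {R : realType} {n : nat}.
Notation C := R[i].
Implicit Types (f g h : C -> 'cV[C]_n).
Implicit Types (Theta : C -> 'M[C]_n).

Lemma fourier_horner (P : {poly C}) (k : nat) : fourier (fun z : C => P.[z]) k =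
  P`_k.
Proof.
transitivity (fourier (fun z : C => \sum_(i < (size P + k).+1) P`_i * z ^ i) k).
  apply: eq_fourier => t; rewrite (@horner_coef_wide _ (size P + k).+1)//.
  by rewrite -addnS leq_addr.
rewrite fourier_sum => [|i]; last first.
  apply: (@eq_LT _ _ (fun z => P`_i * (z ^ i * z ^ (- k%:Z)))) => [t|];
    first by rewrite mulrA.
  by apply: LTZ => //; apply/LT2_LT1/LT2_Mexprz; exact: LT2_exprz.
have kS : (k < (size P + k).+1)%N by rewrite ltnS leq_addl.
rewrite (bigD1 (Ordinal kS))//= big1 => [|i ik].
  by rewrite fourierZ ?fourier_exprz ?eqxx ?mulr1 ?addr0//; exact: LT2_exprz.
rewrite fourierZ ?fourier_exprz; last exact: LT2_exprz.
rewrite (_ : (i%:Z == k) = false) ?mulr0//.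
by apply/negP => /eqP[ik']; move/eqP: ik; apply; apply/val_inj.
Qed.

(** The coefficients of 1 / (1 - mu z) are the powers of mu, and those of a
    square integrable function cannot stay away from 0. *)
Lemma kernel_lt1 (mu : C) (a : C -> C) : Hardy 2%:E a ->
  aeT (fun z => (1 - mu * z) * a z = 1) -> sqabs mu < 1.
Proof.
move=> Ha aE; have La := Hardy_LT Ha.
have rec (k : int) : fourier a k - mu * fourier a (k - 1) = (k == 0)%:R.
  rewrite -[RHS]mul1r -fourier_cst -fourier_shift -fourierZ; last exact: LT2_Mexprz.
  have L1 := LT2_Mexprz 1 La.
  rewrite -fourierB//; last exact: LTZ.
  apply: fourier_ae.
  - by apply: (LT_meas (p := 2%:E)); apply: LT2B => //; exact: LTZ.
  - exact: measT_cst.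
  - by apply: aeTS aE => t <-; rewrite expr1z; ring.
have coef (k : nat) : fourier a k = mu ^+ k.
  elim: k => [|k IH].
    have am1 : fourier a (0 - 1) = 0 by have [_ ->] := Ha.
    by have := rec 0; rewrite am1 mulr0 subr0 expr0.
  have := rec k.+1; rewrite (_ : k.+1%:Z - 1 = k); last by rewrite intS addrC addKr.
  by rewrite IH exprS => /eqP; rewrite subr_eq0 => /eqP.
have [P hP] := Hardy2_approx Ha ltr01.
have LP := LT2_horner P.
have := le_lt_trans (sqabs_fourier (size P) (LT2B La LP)) hP.
rewrite fourierB// fourier_horner nth_default// subr0 coef.
rewrite (_ : sqabs (mu ^+ size P) = sqabs mu ^+ size P); last first.
  by elim: (size P) => [|k IH]; rewrite ?expr0 ?sqabs1// !exprS sqabsM IH.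
by apply: contraTT; rewrite -!leNgt => h; exact: exprn_ege1.
Qed.

Lemma model_space_ae Theta f g : inner Theta -> measmx g ->
  aeT (fun z => f z = g z) -> model_space Theta f -> model_space Theta g.
Proof.
move=> iT mg fg [Hf Kf]; have Hg : Hardymx 2%:E g.
  by move=> i j; apply: Hardy2_ae (Hf i j) => //; apply: aeTS fg => t ->.
split => // h Hh; rewrite -(Kf h Hh).
have LTh : LTmx 2%:E (fun z => Theta z *m h z).
  by apply: LTmx_mul; [exact: inner_LT|exact: Hardymx_LT].
apply: dotT_ae => //; try exact: LTmx_meas LTh.
- exact: LTmx_meas (Hardymx_LT Hf).
- by apply: aeTS fg => t ->.
Qed.

(** An eigenvector h of the backward shift satisfies (1 - mu z) h = h^(0),
    which makes it a scalar function times a constant vector. *)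
Lemma model_space_kernel Theta d f : inner Theta -> deg_le d Theta ->
  model_space Theta f -> ~ aeT (fun z => f z = 0) ->
  exists (mu : C) (v : 'cV[C]_n) (a : C -> C),
    [/\ v != 0, Hardy 2%:E a, aeT (fun z => (1 - mu * z) * a z = 1)
      & model_space Theta (fun z => a z *: v)].
Proof.
move=> iT dT Kf nf; have [h [mu [Kh nh Sh]]] := bshift_eigenvector iT dT Kf nf.
pose v := fhat0 h; have [Hh _] := Kh.
have hv : aeT (fun z => (1 - mu * z) *: h z = v).
  apply: aeTS Sh => t; rewrite /bshift -/v => E.
  have {}E : h (cis t) - v = (cis t * mu) *: h (cis t).
    by rewrite -scalerA -E scalerA -[X in X * _]expr1z -expfzDr ?cis_neq0// subrr
      expr0z scale1r.
  by rewrite scalerBl scale1r [mu * _]mulrC -E subKr.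
have q0 : (1 - mu *: 'X : {poly C}) != 0.
  apply/eqP => /(congr1 (fun p : {poly C} => p.[0])).
  by rewrite !hornerE ?mulr0 ?subr0 => /eqP; rewrite oner_eq0.
have qn : aeT (fun z => 1 - mu * z != 0).
  by apply: aeTS (aeT_horner_neq0 q0) => t; rewrite !hornerE.
have v0 : v != 0.
  apply/eqP => v0; apply: nh; apply: aeTS (aeTI hv qn) => t [/eqP].
  by rewrite v0 scaler_eq0 => /orP[->//|/eqP].
have [i vi] : exists i, v i 0 != 0.
  by have /cV0Pn := v0.
pose a z := (v i 0)^-1 * h z i 0.
have aE : aeT (fun z => (1 - mu * z) * a z = 1).
  apply: aeTS hv => t /matrixP/(_ i 0); rewrite mxE => E.
  by rewrite /a mulrCA E mulVf.
have Ha : Hardy 2%:E a by exact: Hardy2Z.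
exists mu, v, a; split => //.
apply: model_space_ae Kh => //.
  move=> j k; apply: (@eq_measT _ (fun z => v j k * a z)) => [t|].
    by rewrite [RHS]mxE mulrC.
  by apply: measTM; [exact: measT_cst|exact: LT_meas (Hardy_LT Ha)].
apply: aeTS (aeTI aE hv) => t [E1 E2].
by rewrite -E2 scalerA mulrC E1 scale1r.
Qed.

End Kernels.

(** * Division by Blaschke-Potapov factors *)

Section BlaschkePotapovFactor.
Context {R : realType} {n : nat}.
Notation C := R[i].
Local Open Scope sesquilinear_scope.
Implicit Types (f g h : C -> 'cV[C]_n).
Implicit Types (Theta : C -> 'M[C]_n) (P : 'M[C]_n).

Lemma adjmxM m p q (A : 'M[C]_(m, p)) (B : 'M[C]_(p, q)) : (A *m B)^t* =
  B^t* *m A^t*.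
Proof. by rewrite trmx_mul map_mxM. Qed.

Lemma adjmxE m p (A : 'M[C]_(m, p)) i j : A^t* i j = (A j i)^*.
Proof. by rewrite !mxE. Qed.

Lemma adjmxK m p (A : 'M[C]_(m, p)) : A^t*^t* = A.
Proof. by apply/matrixP => i j; rewrite !adjmxE conjCK. Qed.

Lemma adjmx_factor (b : C) P : P^t* = P ->
  (b *: P + (1%:M - P))^t* = b^* *: P + (1%:M - P).
Proof.
move=> PJ; apply/matrixP => i j; rewrite adjmxE.
have Pij : P i j = (P j i)^* by rewrite -adjmxE PJ.
rewrite !mxE rmorphD rmorphB rmorphM /= -Pij [j == i]eq_sym.
by case: (i == j); rewrite ?rmorph1 ?rmorph0.
Qed.

Lemma unitary_factor (b : C) P : orthogonal_projection P -> b^* * b = 1 ->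
  (b *: P + (1%:M - P))^t* *m (b *: P + (1%:M - P)) = 1%:M.
Proof.
move=> [PP PJ] bb; rewrite adjmx_factor//.
have PQ : P *m (1%:M - P) = 0 by rewrite mulmxBr mulmx1 PP subrr.
have QP : (1%:M - P) *m P = 0 by rewrite mulmxBl mul1mx PP subrr.
have QQ : (1%:M - P) *m (1%:M - P) = 1%:M - P by rewrite mulmxBl mul1mx PQ subr0.
have S : P + (1%:M - P) = 1%:M by rewrite addrC subrK.
move: (1%:M - P) PQ QP QQ S => Q PQ QP QQ S.
rewrite mulmxDl !mulmxDr -!scalemxAl -!scalemxAr PP PQ QP QQ scalerA bb scale1r.
by rewrite !scaler0 addr0 add0r.
Qed.

Definition line_proj (v : 'cV[C]_n) : 'M[C]_n :=
  ((v^t* *m v) 0 0)^-1 *: (v *m v^t*).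

Lemma dotv_self (v : 'cV[C]_n) : (v^t* *m v) 0 0 = (\sum_i sqabs (v i 0))%:C%C.
Proof.
rewrite mxE rmorph_sum; apply: eq_bigr => i _.
by rewrite adjmxE mulrC mulCJ.
Qed.

Lemma dotv_self_neq0 (v : 'cV[C]_n) : v != 0 -> (v^t* *m v) 0 0 != 0.
Proof.
apply: contraNN; rewrite dotv_self => /eqP/(congr1 (fun x : C => complex.Re x))
  /= /eqP.
rewrite psumr_eq0 => [/allP H|i _]; last exact: sqabs_ge0.
apply/eqP/matrixP => i j; rewrite ord1 mxE; apply/eqP.
by rewrite -sqabs_eq0; apply: (H i); rewrite mem_index_enum.
Qed.

Lemma line_proj_mulr (v : 'cV[C]_n) : v != 0 -> v^t* *m line_proj v = v^t*.
Proof.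
move=> v0; rewrite -scalemxAr mulmxA [X in _ *:
  (X *m _)]mx11_scalar mul_scalar_mx scalerA.
by rewrite mulVf ?scale1r// dotv_self_neq0.
Qed.

Lemma line_proj_orth (v : 'cV[C]_n) : v != 0 -> orthogonal_projection (line_proj v).
Proof.
move=> v0; split.
  by rewrite {1}/line_proj -scalemxAl -mulmxA line_proj_mulr.
apply/matrixP => i j; rewrite adjmxE /line_proj [in LHS]mxE [in RHS]mxE rmorphM /=.
congr (_ * _).
  by rewrite dotv_self fmorphV; congr (_^-1); apply: complex_eqP;
    rewrite ?ReImE /= ?oppr0.
rewrite -[in LHS]adjmxE adjmxM adjmxK.
by [].
Qed.

Lemma Hardyoo_LT (f : C -> C) : LT +oo%E f -> Hardy 2%:E f -> Hardy +oo%E f.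
Proof. by move=> Lf [_ ff]. Qed.

Lemma Hardymxoo_cst m p (A : 'M[C]_(m, p)) : Hardymx +oo%E (fun=> A).
Proof.
move=> i j; apply: (@eq_Hardy _ _ (fun z => ((A i j)%:P).[z])) => [t|].
  by rewrite hornerC.
exact: Hardyoo_horner.
Qed.

Lemma dotT_self_eq0 f : LTmx 2%:E f -> dotT f f = 0 -> aeT (fun z => f z = 0).
Proof.
move=> Lf; rewrite dotT_ip// (eq_bigr (fun i => (nsq (fun z => f z i 0))%:C%C));
  last first.
  by move=> i _; rewrite ip_self.
rewrite -rmorph_sum => /(congr1 (fun x : C => complex.Re x)) /= /eqP.
rewrite psumr_eq0 => [/allP H|i _]; last exact: nsq_ge0.
apply: aeT_col => i; apply: nsq_eq0_ae; first exact: Lf.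
by apply/eqP; apply: (H i); rewrite mem_index_enum.
Qed.

Section Division.
Context (Theta : C -> 'M[C]_n) (mu : C) (v : 'cV[C]_n) (a : C -> C).
Context (iT : inner Theta) (v0 : v != 0) (Ha : Hardy 2%:E a).
Context (aE : aeT (fun z => (1 - mu * z) * a z = 1)).
Context (Kav : model_space Theta (fun z => a z *: v)).

(* The Blaschke factor vanishing at the conjugate of mu, written in terms of
   a = 1 / (1 - mu z) in order to inherit its measurability and its analyticity. *)
Let b (z : C) := (z - mu^*) * a z.
Let P := line_proj v.
Definition elem_factor (z : C) : 'M[C]_n := b z *: P + (1%:M - P).
Notation B := elem_factor.
Definition quotient_factor (z : C) := adjoint B z *m Theta z.
Notation Psi := quotient_factor.

(** On the circle, the conjugate of (z^-1 - mu) a = z^-1. *)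
Lemma kernel_conj : aeT (fun z => (z - mu^*) * (a z)^* = z).
Proof.
apply: aeTS aE => t E; rewrite -[RHS]mulr1 -(rmorph1 Num.conj) -E rmorphM mulrA.
by congr (_ * _); rewrite rmorphB rmorph1 rmorphM /= cisJ; field; exact: cis_neq0.
Qed.

Lemma blaschke_unimodular : aeT (fun z => (b z)^* * b z = 1).
Proof.
apply: aeTS (aeTI aE kernel_conj) => t [E1 E2].
have -> : (b (cis t))^* * b (cis t) =
    ((cis t)^-1 - mu) * a (cis t) * ((cis t - mu^*) * (a (cis t))^*).
  by rewrite /b rmorphM rmorphB /= conjCK cisJ; ring.
rewrite E2 -[RHS]E1.
by field; exact: cis_neq0.
Qed.

Lemma Hardyoo_b : Hardy +oo%E b.
Proof.
have Hb : Hardy 2%:E b.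
  apply: (@eq_Hardy _ _ (fun z => ('X - (mu^*)%:P).[z] * a z)) => [t|].
    by rewrite hornerXsubC.
  by apply: Hardy2M => //; exact: Hardyoo_horner.
apply: Hardyoo_LT => //; apply/LT_ooP; split; first exact: LT_meas (Hardy_LT Hb).
exists 1; apply: aeTS blaschke_unimodular => t.
rewrite mulrC mulCJ => /(congr1 (fun x : C => complex.Re x)) /= ->.
by [].
Qed.

Lemma elem_factor_inner : inner B.
Proof.
split; last first.
  apply: aeTS blaschke_unimodular => t bb; apply: unitary_factor => //.
  exact: line_proj_orth.
move=> i j; have [Lb Hb] := Hardyoo_b.
apply: (@eq_Hardy _ _ (fun z => P i j * b z + (1%:M - P) i j)) => [t|].
  by rewrite [RHS]mxE [(b _ *: P) i j]mxE mulrC.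
apply: Hardyoo_LT.
  by apply: LTD => //; [exact: LTZ|exact: LToo_cst].
by apply: Hardy2D; [apply: Hardy2Z; exact/Hardyoo_2/Hardyoo_b|exact: Hardy2_cst].
Qed.

Lemma elem_factorK : aeT (fun z => Theta z = B z *m Psi z).
Proof.
by apply: aeTS (inner_mulV elem_factor_inner) => t E; rewrite mulmxA E mul1mx.
Qed.

(** On the circle the conjugate of b is (z^-1 - mu) times that of a. Hence for
    k = - (m + 1) this coefficient is the inner product of Theta g and a v,
    where g = (z^m - mu z^(m+1)) e_j is in H^2. *)
Lemma fourier_quotient_kernel (j : 'I_n) (k : int) : k < 0 ->
  fourier (fun z => (b z)^* * (v^t* *m Theta z) 0 j) k = 0.
Proof.
case: k => // m _; have [Hav Kav0] := Kav.
pose p : {poly C} := ('X^m - mu *: 'X^(m.+1))%R.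
pose g z : 'cV[C]_n := p.[z] *: delta_mx j 0.
have Hg : Hardymx 2%:E g.
  move=> i k; apply: (@eq_Hardy _ _ (fun z => (delta_mx j 0 : 'cV[C]_n)
    i k * p.[z])) => [t|].
    by rewrite [RHS]mxE mulrC.
  by apply: Hardy2Z; exact: Hardy2_horner.
have HTg : Hardymx 2%:E (fun z => Theta z *m g z) by apply: Hardymx_mul => //;
  case: iT.
transitivity ((dotT (fun z => a z *: v) (fun z => Theta z *m g z))^*); last first.
  by rewrite (Kav0 g Hg) rmorph0.
rewrite -(dotTJ (Hardymx_LT Hav) (Hardymx_LT HTg)).
apply: eq_intT => t.
have -> : (adjoint (fun z => a z *: v) (cis t) *m (Theta (cis t) *m g (cis t)))
  0 0 =
    (a (cis t))^* * p.[cis t] * (v^t* *m Theta (cis t)) 0 j.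
  rewrite /adjoint /g -scalemxAr -scalemxAr mulmxA -colE [LHS]mxE [in LHS]mxE.
  rewrite linearZ /= map_mxZ -scalemxAl [in LHS]mxE.
  by ring.
rewrite NegzE opprK -exprnP.
rewrite /b rmorphM rmorphB /= conjCK cisJ /p !hornerE ?hornerXn exprS.
by field; exact: cis_neq0.
Qed.

(** The only term that could have coefficients of negative index is the
    conjugate of b times P Theta, and P Theta = v (v^* Theta) / |v|^2 reduces
    it to [fourier_quotient_kernel]. *)
Lemma quotient_factor_inner : inner Psi.
Proof.
have iB := elem_factor_inner.
split; last first.
  apply: aeTS (aeTI (inner_mulV iB) iT.2) => t [E1 E2].
  by rewrite /quotient_factor adjointM adjointK -mulmxA [X in _ *m X]mulmxA E1
    mul1mx.
move=> i j; split.
  by apply: LTmxoo_mul; [apply: LTmx_adj => //|]; exact: inner_LT.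
move=> k k0; have [HT _] := iT.
pose s := ((v^t* *m v) 0 0)^-1 * v i 0.
pose w z := ((1%:M - P) *m Theta z) i j.
pose u z := (b z)^* * (v^t* *m Theta z) 0 j.
have HvT : Hardymx 2%:E (fun z => v^t* *m Theta z).
  by apply: Hardymx_mul; [exact: Hardymxoo_cst|exact: Hoo_H2].
have Hw : Hardy 2%:E w.
  exact: (Hardymx_mul (Hardymxoo_cst (1%:M - P)) (Hoo_H2 HT) i j).
have Lu : LT 2%:E u.
  apply: LTooM; last exact: Hardymx_LT.
  by apply: LTJ => //; exact: Hardy_LT Hardyoo_b.
transitivity (fourier (fun z => s * u z + w z) k).
  apply: eq_fourier => t; rewrite /quotient_factor /adjoint adjmx_factor;
    last first.
    by have [] := line_proj_orth v0.
  rewrite mulmxDl [LHS]mxE; congr (_ + _).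
  rewrite /P /line_proj scalerA -scalemxAl -mulmxA [LHS]mxE [X in _ * X]mxE
    big_ord1.
  by rewrite /s /u; ring.
rewrite fourierD//; [|exact: LTZ|exact: Hardy_LT].
rewrite fourierZ// fourier_quotient_kernel// mulr0 add0r.
by have [_ ->] := Hw.
Qed.

(** v^* B = b v^*, and b times the conjugate of a is z a: the integrand is z
    times a product of two functions of H^2. *)
Lemma elem_factor_ortho f : Hardymx 2%:E f ->
  dotT (fun z => B z *m f z) (fun z => a z *: v) = 0.
Proof.
move=> Hf; have [Hav _] := Kav.
have HvT : Hardymx 2%:E (fun z => v^t* *m f z).
  by apply: Hardymx_mul => //; exact: Hardymxoo_cst.
rewrite -(fourier_Hardy2M Ha (HvT 0 0) (ltrN10 int)).
have HBf : Hardymx 2%:E (fun z => B z *m f z) by apply: Hardymx_mul => //;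
  have [] := elem_factor_inner.
apply: intT_ae.
- exact: (measmx_mul (measmx_adj (LTmx_meas (Hardymx_LT Hav)))
  (LTmx_meas (Hardymx_LT HBf))).
- apply: measTM; last exact: measT_exprz.
  by apply: measTM; [exact: LT_meas (Hardy_LT Ha)|exact:
    LT_meas (Hardymx_LT HvT 0 0)].
apply: aeTS kernel_conj => t E.
have -> : adjoint (fun z => a z *: v) (cis t) = (a (cis t))^* *: v^t*.
  by rewrite /adjoint linearZ /= map_mxZ.
rewrite opprK expr1z -scalemxAl mulmxA.
have -> : v^t* *m B (cis t) = b (cis t) *: v^t*.
  by rewrite mulmxDr mulmxBr -scalemxAr line_proj_mulr// mulmx1 subrr addr0.
rewrite -scalemxAl scalerA [LHS]mxE.
set x := (_ *m _) 0 0.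
transitivity (((cis t - mu^*) * (a (cis t))^*) * (a (cis t) * x)).
  by rewrite /b; ring.
by rewrite E; ring.
Qed.

(** Multiplication by B embeds the model space of Psi into that of Theta, and
    its image misses the kernel a v, to which it is orthogonal. *)
Lemma deg_le_quotient d : deg_le d.+1 Theta -> deg_le d Psi.
Proof.
move=> dT k f Kf If; rewrite -ltnS.
have iB := elem_factor_inner; have [HB _] := iB.
have [Hav _] := Kav.
have HBf i : Hardymx 2%:E (fun z => B z *m f i z).
  by apply: Hardymx_mul => //; have [] := Kf i.
have Kh := model_space_fcons Kav.
pose F := fcons (fun z => a z *: v) (fun i z => B z *m f i z).
have KF i : model_space Theta (F i).
  apply: Kh => {}i; split; first exact: HBf.
  move=> g Hg; rewrite dotT_adjmulmx; have [_ Kf0] := Kf i.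
  rewrite -(Kf0 g Hg); apply: eq_intT => t; congr ((_ *m _) _ _).
  by rewrite /adjoint /quotient_factor mulmxA.
apply: (dT _ F KF) => c c0.
have LF i : LTmx 2%:E (F i) by have [h _] := KF i; exact: Hardymx_LT.
have c00 : c ord0 = 0.
  have Lav := Hardymx_LT Hav.
  have := dotT_lin c LF Lav; rewrite big_ord_recl [F ord0]fcons0 big1 => [|i _];
    last first.
    by rewrite [F _]fconsS elem_factor_ortho ?mulr0//; have [] := Kf i.
  rewrite addr0 (@dotT_ae _ _ _ _ (fun=> 0) (fun=> 0)); last first.
  - by apply: aeTS c0 => t ->; rewrite !mulmx0.
  - exact: LTmx_meas (LTmx2_cst 0).
  - exact: LTmx_meas (LTmx2_cst 0).
  - exact: LTmx_meas Lav.
  - by have [h _] := model_space_lin c iT KF; exact: LTmx_meas (Hardymx_LT h).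
  rewrite (_ : dotT (fun=> 0) _ = 0); last first.
    by rewrite -[RHS]intT0; apply: eq_intT => t; rewrite mulmx0 mxE.
  move/esym/eqP; rewrite mulf_eq0 => /orP[/eqP//|/eqP /(dotT_self_eq0 Lav) h0].
  have [t [E1 /eqP E2]] := aeT_ex (aeTI aE h0).
  move: E2; rewrite scaler_eq0 (negbTE v0) orbF => /eqP a0.
  by move: E1; rewrite a0 mulr0 => /esym/eqP; rewrite oner_eq0.
have cS : forall i, c (lift ord0 i) = 0.
  apply: If; apply: aeTS (aeTI c0 iB.2) => t [].
  rewrite big_ord_recl c00 scale0r add0r => E1 E2.
  have {}E1 : B (cis t) *m \sum_(i < k) c (lift ord0 i) *: f i (cis t) = 0.
    rewrite -[RHS]E1 mulmx_sumr; apply: eq_bigr => i _.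
    by rewrite /F fconsS -scalemxAr.
  by rewrite -[LHS]mul1mx -E2 -mulmxA E1 mulmx0.
by move=> i; case: (unliftP ord0 i) => [j ->|->].
Qed.

End Division.

(** The unitary constant of Psi is moved to the front by conjugating the
    projection P with it. *)
Lemma finite_blaschke_potapov_cons Theta Psi (l : C) P :
  `|l| < 1 -> orthogonal_projection P ->
  aeT (fun z => Theta z = (blaschke l z *: P + (1%:M - P)) *m Psi z) ->
  finite_blaschke_potapov Psi -> finite_blaschke_potapov Theta.
Proof.
move=> l1 [PP PJ] TE [M [nu [ls [Ps [nuU ls1 Ps1 PsiE]]]]].
have nu1 : nu *m nu^t* = 1%:M by apply/unitarymxP.
have nu2 : nu^t* *m nu = 1%:M by exact: mulmx1C.
pose Q := nu^t* *m P *m nu.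
exists M.+1, nu, (fun i => oapp ls l (unlift ord0 i)),
  (fun i => oapp Ps Q (unlift ord0 i)).
split => //.
- by move=> i; case: unliftP => [j _|_] /=.
- move=> i; case: unliftP => [j _|_] //=; split.
    by rewrite /Q !mulmxA -[X in X *m P]mulmxA nu1 mulmx1 -[X in X *m nu]mulmxA PP.
  by rewrite /Q !adjmxM adjmxK PJ mulmxA.
apply: aeTS (aeTI TE PsiE) => t [-> ->].
rewrite big_ord_recl unlift_none /=.
under [in RHS]eq_bigr do rewrite liftK /=.
rewrite !mulmxA; congr (_ *m _).
rewrite mulmxDr mulmxBr mulmxDl mulmxBl mulmx1 mul1mx -scalemxAr -scalemxAl.
by rewrite /Q !mulmxA nu1 !mul1mx.
Qed.

Lemma sqabs_norm_lt1 (x : C) : sqabs x < 1 -> `|x| < 1.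
Proof.
move=> x1; rewrite -(@expr_lt1 _ 2)// normCK mulCJ.
by rewrite -[X in _ < X]/((1 : R)%:C%C) ltcR.
Qed.

(** Induction on the dimension: a nontrivial model space contains a kernel,
    and dividing by the factor that belongs to it lowers the dimension. *)
Lemma inner_finite_deg d Theta : inner Theta -> deg_le d Theta ->
  finite_blaschke_potapov Theta.
Proof.
have [m] := ubnP d; elim: m d Theta => // m IH d Theta dm iT dT.
have [K0|/existsNP[f /not_implyP[Kf nf]]] :=
  pselect (forall f, model_space Theta f -> aeT (fun z => f z = 0)).
  have [U UU TU] := inner_trivial_model iT K0.
  exists 0%N, U, (fun _ => 0), (fun _ => 0); split => //; try by case.
  by apply: aeTS TU => t ->; rewrite big_ord0 mulmx1.
case: d dm dT => [_|d dm] dT.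
  have := dT 1%N (fun=> f) (fun=> Kf); rewrite ltnn => H; exfalso.
  suff : false by []. 
  apply: H => c c0 i; rewrite ord1.
  by apply: (aeT_scale_eq0 nf); apply: aeTS c0 => t; rewrite big_ord1.
have [mu [v [a [v0 Ha aE Kav]]]] := model_space_kernel iT dT Kf nf.
have mu1 := kernel_lt1 Ha aE.
apply: (@finite_blaschke_potapov_cons _ (quotient_factor Theta mu v a) (mu^*)
  (line_proj v)).
- by rewrite norm_conjC; exact: sqabs_norm_lt1.
- exact: line_proj_orth.
- apply: aeTS (aeTI aE (elem_factorK Theta v0 Ha aE)) => t [E1 {1}->].
  rewrite /elem_factor; congr ((_ *: _ + _) *m _).
  have n0 : 1 - mu * cis t != 0.
    by apply: contra_eq_neq E1 => ->; rewrite mul0r eq_sym oner_eq0.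
  rewrite /blaschke conjCK.
  by congr (_ * _); apply: (mulfI n0); rewrite E1 mulfV.
- have iPsi := quotient_factor_inner iT v0 Ha aE Kav.
  have dPsi := deg_le_quotient iT v0 Ha aE Kav dT.
  exact: (IH d _ dm iPsi dPsi).
Qed.

End BlaschkePotapovFactor.

(** * Rational functions *)

Section Rational.
Context {R : realType} {n : nat}.
Notation C := R[i].
Implicit Types (f g h : C -> 'cV[C]_n).
Implicit Types (Phi Theta Pi Pe : C -> 'M[C]_n).

Lemma rational_common_denominator Phi : rational_mx Phi ->
  exists (q : {poly C}) (P : 'M[{poly C}]_n), q != 0 /\
    aeT (fun z => q.[z] *: Phi z = map_mx (horner^~ z) P).
Proof.
move=> rPhi.
have /fin_all_exists[pq Hpq] : forall x : 'I_n * 'I_n, exists pq :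
  {poly C} * {poly C},
    pq.2 != 0 /\ aeT (fun z => Phi z x.1 x.2 = pq.1.[z] / pq.2.[z]).
  by move=> [i j]; have [p [q [q0 H]]] := rPhi i j; exists (p, q).
exists (\prod_x (pq x).2).
exists (\matrix_(i, j) ((pq (i, j)).1 * \prod_(x | x != (i, j)) (pq x).2)); split.
  by apply/prodf_neq0 => x _; have [] := Hpq x.
have H1 := aeT_forall (fun x => (Hpq x).2).
have H2 := aeT_forall (fun x => aeT_horner_neq0 (Hpq x).1).
apply: aeTS (aeTI H1 H2) => t [E1 E2]; apply/matrixP => i j.
rewrite !mxE (bigD1 (i, j))//= !hornerM.
have := E1 (i, j); have := E2 (i, j); rewrite /= => d ->.
by field.
Qed.

(** Multiplication by the conjugate of a polynomial of degree less than N
    lowers the indices of the coefficients by less than N. *)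
Lemma fourier_conj_horner (P : {poly C}) (N : nat) (f : C -> C) (k : int) :
  (size P <= N)%N ->
  Hardy 2%:E f -> k + N%:Z <= 0 -> fourier (fun z => (P.[z])^* * f z) k = 0.
Proof.
move=> PN Hf kN; have Lf := Hardy_LT Hf.
transitivity (fourier (fun z => \sum_(i < size P)
  (P`_i)^* * (f z * z ^ (- i%:Z))) k).
  apply: eq_fourier => t; rewrite horner_coef rmorph_sum mulr_suml.
  apply: eq_bigr => i _; rewrite rmorphM /= exprnP cisXJ.
  by ring.
rewrite fourier_sum => [|i]; last first.
  apply: (@eq_LT _ _ (fun z => (P`_i)^* * (f z * z ^ (- i%:Z)
    * z ^ (- k)))) => [t|].
    by rewrite mulrA.
  by apply: LTZ => //; apply/LT2_LT1/LT2_Mexprz; exact: LT2_Mexprz.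
rewrite big1// => i _; rewrite fourierZ; last exact: LT2_Mexprz.
rewrite fourier_shift opprK; have [_ ->] := Hf; rewrite ?mulr0//.
apply: lt_le_trans kN; rewrite ltrD2l ltz_nat.
exact: leq_trans (ltn_ord i) PN.
Qed.

(** The function P^* f = q^* Phi^* f is orthogonal to H^2 and has no
    coefficient of index below -N, where N bounds the degrees of the entries
    of P. It is thus determined by n N coefficients, and it determines f
    because q and Phi^* are cancellable. *)
Lemma rational_deg_le Phi Pi Pe : Hardymx +oo%E Phi ->
  inner_outer_factorization Phi Pi Pe -> rational_mx Phi ->
  exists d, deg_le d Pi.
Proof.
move=> HPhi ioP /rational_common_denominator[q [P [q0 qP]]].
have LPhi : LTmx +oo%E Phi := Hardymx_LT HPhi.
pose Pz (z : C) : 'M[C]_n := map_mx (horner^~ z) P.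
have HPz : Hardymx +oo%E Pz.
  move=> i j; apply: (@eq_Hardy _ _ (fun z => (P i j).[z])) => [t|];
    first by rewrite mxE.
  exact: Hardyoo_horner.
have LPz : LTmx +oo%E (adjoint Pz) by apply: LTmx_adj => //; exact: Hardymx_LT.
pose N := (\sum_i \sum_j size (P i j))%N.
have sN i j : (size (P i j) <= N)%N.
  by rewrite /N (bigD1 i)//= (bigD1 j)//= -addnA leq_addr.
pose w f z := adjoint Pz z *m f z.
have Lw f : LTmx 2%:E f -> LTmx 2%:E (w f) by move=> Lf; exact: LTmx_mul.
have wE f : aeT (fun z => w f z = (q.[z])^* *: (adjoint Phi z *m f z)).
  apply: aeTS qP => t E; rewrite /w scalemxAl; congr (_ *m _).
  by apply/matrixP => i j; rewrite adjointE /Pz -E !mxE rmorphM.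
have wpos f j (k : nat) : model_space Pi f -> fourier (fun z => w f z j 0) k = 0.
  move=> Kf; have [Hf _] := Kf; have Lf := Hardymx_LT Hf.
  pose h z : 'cV[C]_n := q.[z] *: (z ^ k%:Z *: delta_mx j 0).
  have Hh : Hardymx 2%:E h.
    move=> i l; apply: (@eq_Hardy _ _ (fun z => q.[z] * (z ^ k%:Z *:
      (delta_mx j 0 : 'cV[C]_n)) i l)) => [t|].
      by rewrite [RHS]mxE.
    by apply: Hardy2M; [exact: Hardyoo_horner|exact: Hardymx_monomial].
  rewrite -dotT_monomial; last exact: Lw.
  rewrite -(model_space_ortho HPhi ioP Kf Hh).
  have Hm := Hardymx_monomial (R := R) j k.
  apply: dotT_ae.
  - exact: LTmx_meas (Lw _ Lf).
  - exact: LTmx_meas (Hardymx_LT Hm).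
  - exact: LTmx_meas Lf.
  - by apply: (LTmx_meas (p := 2%:E)); apply: LTmx_mul => //; exact: Hardymx_LT.
  apply: aeTS qP => t E.
  have Eh : Phi (cis t) *m h (cis t) = Pz (cis t) *m (cis t ^ k%:Z *: delta_mx j 0).
    by rewrite /Pz -E /h -scalemxAr scalemxAl.
  by rewrite /w mulmxA /adjoint Eh trmx_mul map_mxM.
have wneg f j (k : int) : Hardymx 2%:E f -> k + N%:Z <= 0 ->
  fourier (fun z => w f z j 0) k = 0.
  move=> Hf kN; transitivity (fourier (fun z => \sum_i ((P i j).[z])^* * f z i 0)
    k).
    by apply: eq_fourier => t; rewrite /w mxE; apply: eq_bigr => i _;
      rewrite adjointE mxE.
  rewrite fourier_sum => [|i]; last first.
    apply: LT2_LT1; apply: LT2_Mexprz; apply: LTooM; last exact: Hardymx_LT.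
    by apply: LTJ => //; exact: LToo_horner.
  by rewrite big1// => i _; exact: (fourier_conj_horner (sN i j)).
have w0 f : model_space Pi f ->
    (forall j (m : 'I_N), fourier (fun z => w f z j 0) (- m.+1%:Z) = 0) ->
      aeT (fun z => f z = 0).
  move=> Kf cf; have [Hf _] := Kf; have Lf := Hardymx_LT Hf.
  have wf0 : aeT (fun z => w f z = 0).
    apply: aeT_col => j; apply: fourier_eq0_ae; first exact: Lw.
    case=> m; first exact: wpos.
    rewrite NegzE; have [mN|Nm] := ltnP m N; first exact: (cf j (Ordinal mN)).
    apply: wneg => //; rewrite addrC subr_le0 lez_nat.
    exact: leq_trans Nm (leqnSn m).
  apply: (adjoint_inj LPhi ioP Lf).
  apply: aeTS (aeTI (aeTI (wE f) wf0) (aeT_horner_neq0 q0)) => t [[E1 E2] qt].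
  move: E1; rewrite E2 => /esym/eqP; rewrite scaler_eq0 conjC_eq0 (negbTE qt) /=.
  by move/eqP.
exists (n * N)%N => k f Kf If; rewrite leqNgt; apply/negP => kbig.
have Lf i : LTmx 2%:E (f i) by have [h _] := Kf i; exact: Hardymx_LT.
pose M : 'M[C]_(k, n * N) := \matrix_(i < k) mxvec (\matrix_(j < n, m < N)
   fourier (fun z => w (f i) z j 0) (- m.+1%:Z)).
have /rowV0Pn[c /sub_kermxP cM c0] : kermx M != 0.
  rewrite -mxrank_eq0 mxrank_ker subn_eq0 -ltnNge.
  exact: leq_ltn_trans (rank_leq_col _) kbig.
case/eqP: c0; apply/matrixP => i0 i; rewrite ord1 [RHS]mxE.
move: i; apply: If.
have [iP _ _] := ioP.
apply: w0; first exact: model_space_lin.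
move=> j m.
transitivity (fourier (fun z => \sum_i c 0 i * w (f i) z j 0) (- m.+1%:Z)).
  apply: eq_fourier => t; rewrite /w mulmx_sumr summxE; apply: eq_bigr => i _.
  by rewrite -scalemxAr mxE.
rewrite fourier_sum => [|i]; last first.
  apply: (@eq_LT _ _ (fun z => c 0 i * (w (f i)
    z j 0 * z ^ (- - m.+1%:Z)))) => [t|].
    by rewrite mulrA.
  by apply: LTZ => //; apply/LT2_LT1/LT2_Mexprz; exact: Lw.
have /matrixP/(_ 0 (mxvec_index j m)) := cM; rewrite !mxE => E.
rewrite -[RHS]E; apply: eq_bigr => i _.
by rewrite fourierZ; [rewrite [in RHS]mxE mxvecE mxE|exact: Lw].
Qed.

End Rational.

(** * The inner factor *)

Theorem corollary4p34 (R : realType) (n r : nat)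
    (Phi : R[i] -> 'M[R[i]]_n)
    (Phi_i : R[i] -> 'M[R[i]]_(n, r)) (Phi_e : R[i] -> 'M[R[i]]_(r, n)) :
  Hoo Phi ->
  bounded_type (adjoint Phi) ->
  inner_outer_factorization Phi Phi_i Phi_e ->
  ~ aeT (fun z => \det (Phi z) = 0) ->
  exists e : r = n,
    let Psi := fun z => castmx (erefl n, e) (Phi_i z) in
    (forall A Theta : R[i] -> 'M[R[i]]_n,
       left_coprime_factorization Phi A Theta -> (deg Psi <= deg Theta)%E) /\
    (rational_mx Phi -> finite_blaschke_potapov Psi).
Proof.
move=> HPhi _ ioP nd; have [iP oP PhiE] := ioP.
have rn : (r <= n)%N.
  have [t E] := aeT_ex iP.2.
  rewrite -(mxrank1 R[i] r) -E; apply: leq_trans (mxrankM_maxl _ _) _.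
  exact: rank_leq_col.
have nr : (n <= r)%N.
  rewrite leqNgt; apply/negP => nr; apply: nd; apply: aeTS PhiE => t ->.
  apply/eqP; rewrite -[_ == 0]negbK -unitfE -unitmxE -row_free_unit.
  rewrite /row_free neq_ltn; apply/orP; left.
  apply: leq_ltn_trans nr; apply: leq_trans (mxrankM_maxl _ _) _.
  exact: rank_leq_col.
have e : r = n by apply/eqP; rewrite eqn_leq rn nr.
subst r; exists erefl => Psi.
have -> : Psi = Phi_i by apply/funext => z; rewrite /Psi castmx_id.
split.
- move=> A Theta [iT HA _ AE]; exact: (deg_inner_factor_le HPhi ioP iT HA AE).
- move=> rPhi; have [d dP] := rational_deg_le HPhi ioP rPhi.
  exact: (inner_finite_deg iP dP).
Qed.
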